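(* Let $G$ be a finitely generated group with linear divergence, and let $X$ be a Cayley graph of $G$ with respect to a finite generating set. Then $X$ satisfies QR-Assumptions 0, 1 and 2, any two quasi-geodesic rays in $X$ are equivalent under $\simeq$, and hence the QR-poset $P(X)$, and so the quasi-redirecting boundary $\partial_* G$, consists of exactly one point.
   Context: Let $X$ be a metric space with a fixed base point $o$. A $(q,Q)$-quasi-geodesic is a map $\alpha\colon I\to X$, $I\subset\mathbb R$ an interval, with $\frac{|s-t|}{q}-Q\le d(\alpha(s),\alpha(t))\le q|s-t|+Q$. A $(q,Q)$-ray is a $(q,Q)$-quasi-geodesic ray $\alpha\colon[0,\infty)\to X$ with $\alpha(0)=o$. For $r>0$ let $B_r$ denote the closed ball of radius $r$ about $o$. For quasi-geodesic rays $\alpha,\beta,\gamma$: $\gamma$ eventually coincides with $\beta$ if there are $t_\beta,t_\gamma>0$ with $\gamma(t)=\beta(t+t_\beta)$ for all $t\ge t_\gamma$; $\gamma$ quasi-redirects $\alpha$ to $\beta$ at radius $r$ if $\gamma$ and $\alpha$ agree until they first leave $B_r$ (i.e. $\gamma|_r=\alpha|_r$) and $\gamma$ eventually coincides with $\beta$; if moreover $\gamma$ is a $(q,Q)$-ray we say $\alpha$ can be $(q,Q)$-quasi-redirected to $\beta$ at radius $r$. We say $\alpha$ can be $(q,Q)$-quasi-redirected to $\beta$ if this holds at every radius $r>0$, and write $\alpha\preceq\beta$ if this holds for some $(q,Q)$. Write $\alpha\simeq\beta$ if $\alpha\preceq\beta$ and $\beta\preceq\alpha$; the set $P(X)$ of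 $\simeq$-classes, partially ordered by $\preceq$, is the QR-poset. QR-Assumption 0: $X$ is proper and geodesic and there is $\mathfrak q_0$ such that every point of $X$ lies on an infinite $\mathfrak q_0$-quasi-geodesic ray. QR-Assumption 1: every class $\mathbf a\in P(X)$ contains a $\mathfrak q_0$-ray $\underline a$ (a fixed ''central element''). QR-Assumption 2: for every $\mathbf a\in P(X)$ there is a function $f_{\mathbf a}\colon[1,\infty)\times[0,\infty)\to[1,\infty)\times[0,\infty)$ such that whenever $\mathbf b\prec\mathbf a$, every $\mathfrak q$-ray $\beta\in\mathbf b$ can be $f_{\mathbf a}(\mathfrak q)$-quasi-redirected to $\underline a$. When all three assumptions hold, $P(X)$ with the cone-like topology of Qing–Rafi is the quasi-redirecting (QR) boundary $\partial_*X$; it is a quasi-isometry invariant, so $\partial_*G$ is well defined. Divergence: for a one-ended geodesic proper space $X$ with base point $x_0$, $\operatorname{div}_\gamma(a,b,x_0;\delta)$ is the infimum of lengths of paths from $a$ to $b$ avoiding the open ball $B^o(x_0,\delta r-\gamma)$, with $r=\min\{d(x_0,a),d(x_0,b)\}$, and $\operatorname{Div}_\gamma(r,\delta)=\sup_{a,b\in S(x_0,r)}\operatorname{div}_\gamma(a,b,x_0;\delta)$. $G$ has linear divergence if there is $C>0$ with $\operatorname{Div}_2(r,1/2)\le Cr$ for all $r>1$ (up to the usual equivalence $f\preceq g$ iff $f(x)\le Ag(Bx+C)+Dx+E$), i.e. any two points on the sphere $S(x_0,r)$ are joined by a path of length $\le Cr$ outside $B^o(x_0,r/2-2)$. *)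

(* Defs.v *)
From HB Require Import structures.
From mathcomp Require Import all_boot all_order all_algebra.
From mathcomp Require Import all_classical all_reals.
Set Implicit Arguments. Unset Strict Implicit. Unset Printing Implicit Defensive.
Import Order.TTheory GRing.Theory Num.Theory.
Local Open Scope ring_scope.
Local Open Scope classical_set_scope.

Record group := Group {
  gcar :> Type;
  gmul : gcar -> gcar -> gcar;
  gone : gcar;
  ginv : gcar -> gcar;
  gmulA : forall x y z, gmul x (gmul y z) = gmul (gmul x y) z;
  gmul1 : forall x, gmul gone x = x;
  gmulV : forall x, gmul (ginv x) x = gone }.
Arguments gone {_}.

Definition word_eval (G : group) (n : nat) (S : 'I_n -> G)
  (w : seq ('I_n * bool)) : G :=
  foldr (fun l acc => gmul (if l.2 then ginv (S l.1) else S l.1) acc) gone w.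

Definition generates (G : group) (n : nat) (S : 'I_n -> G) : Prop :=
  forall g : G, exists w, word_eval S w = g.

Definition word_dist (R : realType) (G : group) (n : nat) (S : 'I_n -> G)
  (g h : G) : R :=
  inf [set (size w)%:R | w in [set w | word_eval S w = gmul (ginv g) h]].

(* Geometric realization of the Cayley graph: a vertex for each g, and
   for each g and each generator index i an edge of length 1 from g to
   g * S i; CE g i t is the interior point at distance t from g.        *)
Inductive cpoint (R : realType) (G : group) (n : nat) : Type :=
  | CV of G
  | CE of G & 'I_n & {t : R | 0 < t < 1}.
Arguments CV {R G n}.
Arguments CE {R G n}.

Definition cends (R : realType) (G : group) (n : nat) (S : 'I_n -> G)
  (p : cpoint R G n) : seq (G * R) :=
  match p with
  | CV g => [:: (g, 0)]
  | CE g i t => [:: (g, sval t); (gmul g (S i), 1 - sval t)]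
  end.

(* the path metric of the metric graph (all edges of length 1) *)
Definition cdist (R : realType) (G : group) (n : nat) (S : 'I_n -> G)
  (p q : cpoint R G n) : R :=
  let L := [seq x.2 + word_dist R S x.1 y.1 + y.2 | x <- cends S p, y <- cends S q] in
  let base := foldr Num.min (head 0 L) L in
  match p, q with
  | CE g i t, CE h j u =>
      if `[< g = h /\ i = j >] then Num.min `|sval t - sval u| base else base
  | _, _ => base
  end.

Section Generic.
Context {R : realType} {X : Type}.

Definition qgeod (d : X -> X -> R) (q Q : R) (I : set R) (a : R -> X) : Prop :=
  forall s t, I s -> I t ->
    `|s - t| / q - Q <= d (a s) (a t) /\ d (a s) (a t) <= q * `|s - t| + Q.

Definition qray (d : X -> X -> R) (o : X) (q Q : R) (a : R -> X) : Prop :=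
  a 0 = o /\ qgeod d q Q [set t | 0 <= t] a.

Definition is_qray (d : X -> X -> R) (o : X) (a : R -> X) : Prop :=
  exists q Q, 1 <= q /\ 0 <= Q /\ qray d o q Q a.

(* g agrees with a on [0, first exit time of a from B_r] *)
Definition agree_upto (d : X -> X -> R) (o : X) (r : R) (a g : R -> X) : Prop :=
  forall t, 0 <= t -> (forall s, 0 <= s < t -> d o (a s) <= r) -> g t = a t.

Definition restr_eq (d : X -> X -> R) (o : X) (r : R) (g a : R -> X) : Prop :=
  agree_upto d o r a g /\ agree_upto d o r g a.

Definition ev_coincide (g b : R -> X) : Prop :=
  exists tb tg : R, 0 < tb /\ 0 < tg /\ forall t, tg <= t -> g t = b (t + tb).

Definition qredirect_at (d : X -> X -> R) (o : X) (q Q r : R) (a b : R -> X) : Prop :=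
  exists g, qray d o q Q g /\ restr_eq d o r g a /\ ev_coincide g b.

Definition qredirect (d : X -> X -> R) (o : X) (q Q : R) (a b : R -> X) : Prop :=
  forall r, 0 < r -> qredirect_at d o q Q r a b.

Definition qr_le (d : X -> X -> R) (o : X) (a b : R -> X) : Prop :=
  exists q Q, 1 <= q /\ 0 <= Q /\ qredirect d o q Q a b.

Definition qr_eq (d : X -> X -> R) (o : X) (a b : R -> X) : Prop :=
  qr_le d o a b /\ qr_le d o b a.

Definition qr_class (d : X -> X -> R) (o : X) (a : R -> X) : set (R -> X) :=
  [set b | is_qray d o b /\ qr_eq d o a b].

Definition QRposet (d : X -> X -> R) (o : X) : set (set (R -> X)) :=
  [set C | exists a, is_qray d o a /\ C = qr_class d o a].

Definition class_le (d : X -> X -> R) (o : X) (B A : set (R -> X)) : Prop :=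
  exists b a, B b /\ A a /\ qr_le d o b a.

Definition class_lt (d : X -> X -> R) (o : X) (B A : set (R -> X)) : Prop :=
  class_le d o B A /\ ~ class_le d o A B.

Definition proper_space (d : X -> X -> R) : Prop :=
  forall (x : X) (r : R) (u : nat -> X), (forall k, d x (u k) <= r) ->
    exists (phi : nat -> nat) (y : X), (forall k, (phi k < phi k.+1)%N) /\
      forall e : R, 0 < e -> exists N, forall k, (N <= k)%N -> d (u (phi k)) y < e.

Definition geodesic_space (d : X -> X -> R) : Prop :=
  forall x y, exists c : R -> X, c 0 = x /\ c (d x y) = y /\
    forall s t, 0 <= s <= d x y -> 0 <= t <= d x y -> d (c s) (c t) = `|s - t|.

Definition QR_assumption0 (d : X -> X -> R) (q0 Q0 : R) : Prop :=
  proper_space d /\ geodesic_space d /\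
  forall x, exists (a : R -> X) (t : R),
    qgeod d q0 Q0 [set s | 0 <= s] a /\ 0 <= t /\ a t = x.

(* QR-Assumptions 0, 1 and 2 (with a chosen central element ca A of each
   class A) *)
Definition QR_assumptions (d : X -> X -> R) (o : X) : Prop :=
  exists q0 Q0 : R, 1 <= q0 /\ 0 <= Q0 /\ QR_assumption0 d q0 Q0 /\
  exists ca : set (R -> X) -> (R -> X),
    (forall A, QRposet d o A -> A (ca A) /\ qray d o q0 Q0 (ca A)) /\
    (forall A, QRposet d o A ->
      exists f : R * R -> R * R,
        (forall q Q, 1 <= q -> 0 <= Q -> 1 <= (f (q, Q)).1 /\ 0 <= (f (q, Q)).2) /\
        forall B, QRposet d o B -> class_lt d o B A ->
          forall (q Q : R) (b : R -> X), 1 <= q -> 0 <= Q -> B b -> qray d o q Q b ->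
            qredirect d o (f (q, Q)).1 (f (q, Q)).2 b (ca A)).

Definition is_path (d : X -> X -> R) (p : R -> X) : Prop :=
  forall s, 0 <= s <= 1 -> forall e : R, 0 < e -> exists2 del : R, 0 < del &
    forall s', 0 <= s' <= 1 -> `|s - s'| < del -> d (p s) (p s') < e.

Definition path_len_le (d : X -> X -> R) (p : R -> X) (L : R) : Prop :=
  forall (k : nat) (ts : nat -> R), ts 0%N = 0 -> ts k = 1 ->
    (forall i, (i < k)%N -> ts i <= ts i.+1) ->
    \sum_(i < k) d (p (ts i)) (p (ts i.+1)) <= L.

Definition one_ended (d : X -> X -> R) (x0 : X) : Prop :=
  (forall r : R, exists x, r < d x0 x) /\
  forall r : R, exists Rr : R, forall x y, Rr < d x0 x -> Rr < d x0 y ->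
    exists p, is_path d p /\ p 0 = x /\ p 1 = y /\
      forall s, 0 <= s <= 1 -> r < d x0 (p s).

(* linear divergence: Div_2(r,1/2) <= C r for all r > 1 *)
Definition linear_divergence (d : X -> X -> R) (x0 : X) : Prop :=
  exists C : R, 0 < C /\ forall r : R, 1 < r -> forall a b,
    d x0 a = r -> d x0 b = r ->
    exists p, is_path d p /\ p 0 = a /\ p 1 = b /\ path_len_le d p (C * r) /\
      forall s, 0 <= s <= 1 -> r / 2 - 2 <= d x0 (p s).

End Generic.

Arguments cdist R {G n} S p q.
Arguments word_dist R {G n} S g h.

(* Main.v *)
(* Given quasi-geodesic rays a and b and a radius r, weight the space by a large
   constant M inside a ball of radius rho >> r and by 1 outside it. Among the
   concatenations of an initial piece a|[0,t], a weighted path from a t to b s and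
   the tail of b from s, take one that minimises (q + 1) t + cost - s / (2 q) up to
   an error of 1. Linear divergence provides a competitor outside the ball whose
   value is linear in rho, with a factor independent of M. So for M large the
   minimiser avoids the ball of radius rho / 2, and, as shortcutting it along a
   geodesic of length m costs at most M (m + 1), it is a quasi-geodesic with
   constants independent of r. Hence all quasi-geodesic rays are equivalent. In the
   Cayley graph geodesic rays exist by Koenig's lemma, and QR-Assumption 2 is
   vacuous because there is only one class. *)
Require Import Defs.
From HB Require Import structures.
From mathcomp Require Import all_boot all_order all_algebra.
From mathcomp Require Import all_classical all_reals.
From mathcomp Require Import ring lra zify.
Set Implicit Arguments. Unset Strict Implicit. Unset Printing Implicit Defensive.
Import Order.TTheory GRing.Theory Num.Theory.
Local Open Scope ring_scope.
Local Open Scope classical_set_scope.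

Ltac arith := repeat match goal with H : forall _, _ |- _ => clear H end; lra.

(** * Discrete weighted walks, and how geodesics and rectifiable paths yield them *)

Section Walks.
Context {R : realType} {X : Type}.
Variable d : X -> X -> R.
Hypothesis dxx : forall x, d x x = 0.
Hypothesis dC : forall x y, d x y = d y x.
Hypothesis dT : forall x y z, d x z <= d x y + d y z.

Lemma dist_ge0 x y : 0 <= d x y.
Proof. have := dT x y x; rewrite dxx (dC y x); arith. Qed.

(* Discrete paths with jumps of length at most 1; leaving a point x costs
   w x, and c is an upper bound on the total cost. *)
Inductive walk (w : X -> R) : X -> X -> R -> Prop :=
| walk_nil x c : 0 <= c -> walk w x x c
| walk_cons x y z c c' : d x y <= 1 -> walk w y z c -> w x + c <= c' ->
    walk w x z c'.

Lemma walk_le w x y c c' : walk w x y c -> c <= c' -> walk w x y c'.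
Proof.
case=> [{}x {}c c0|{}x z {}y e {}c xz zy we] cc'.
  by apply: walk_nil; arith.
by apply: walk_cons xz zy _; arith.
Qed.

Lemma walk_cat w x y z a b :
  walk w x y a -> walk w y z b -> walk w x z (a + b).
Proof.
move=> xy; elim: xy z b => [{}x c c0|{}x y' {}y c c' xy' _ IH wc] z b yz.
  by apply: walk_le yz _; arith.
by apply: walk_cons xy' (IH _ _ yz) _; arith.
Qed.

Lemma walk_step w x y c : d x y <= 1 -> w x <= c -> walk w x y c.
Proof.
move=> xy wc; apply: walk_cons xy (walk_nil w y (lexx 0)) _; arith.
Qed.

Lemma walk_seq w x y c : walk w x y c -> exists (k : nat) (z : nat -> X),
  [/\ z 0%N = x, z k = y, forall i, (i < k)%N -> d (z i) (z i.+1) <= 1 &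
      \sum_(i < k) w (z i) <= c].
Proof.
elim=> [{}x {}c c0|{}x y' {}y {}c c' xy' _ [k [z [z0 zk zd zw]]] wc].
  by exists 0%N, (fun=> x); split=> //; rewrite big_ord0.
exists k.+1, (fun i => if i is j.+1 then z j else x); split=> //.
  by move=> [|i] //=; [rewrite z0|exact: zd].
by rewrite big_ord_recl /= (le_trans _ wc)// lerD2l.
Qed.

Lemma seq_walk w (z : nat -> X) i j :
    (forall l, (i <= l < i + j)%N -> d (z l) (z l.+1) <= 1) ->
  walk w (z i) (z (i + j)%N) (\sum_(i <= l < i + j) w (z l)).
Proof.
elim: j => [|j IH] zd.
  by rewrite addn0 big_geq//; apply: walk_nil.
rewrite addnS big_nat_recr ?leq_addr//=; apply: walk_cat.
  by apply: IH => l /andP[il lj]; apply: zd; rewrite il addnS ltnS ltnW.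
by apply: walk_step => //; apply: zd; rewrite leq_addr addnS leqnn.
Qed.

Lemma weight_sum_ge (w : X -> R) (z : nat -> X) m n :
  (forall x, 1 <= w x) -> (m <= n)%N ->
  n%:R - m%:R <= \sum_(m <= l < n) w (z l).
Proof.
move=> w1 mn; rewrite -natrB// -[X in X%:R]mulr1n -sumr_const_nat.
by rewrite ler_sum_nat.
Qed.

Lemma chain_dist (z : nat -> X) i j k :
    (forall l, (l < k)%N -> d (z l) (z l.+1) <= 1) -> (i <= j)%N -> (j <= k)%N ->
  d (z i) (z j) <= j%:R - i%:R.
Proof.
move=> zd ij; rewrite -(subnKC ij) natrD addrAC subrr add0r.
elim: (j - i)%N => [|l IH]; first by rewrite addn0 dxx.
rewrite addnS => lk; have := IH (ltnW lk); have := zd _ lk.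
have := dT (z i) (z (i + l)%N) (z (i + l).+1); rewrite -natr1; arith.
Qed.

(** Cut the parameter interval into [m] pieces of length at most 1. Only [b <= a + m%:R] is asked,
    so that a real length can be rounded up. *)
Lemma curve_walk w (M : R) (c : R -> X) (m : nat) (a b : R) :
    0 <= M -> a <= b <= a + m%:R ->
    (forall s, a <= s <= b -> w (c s) <= M) ->
    (forall s t, a <= s <= b -> a <= t <= b -> d (c s) (c t) <= `|s - t|) ->
  walk w (c a) (c b) (M * m%:R).
Proof.
move=> M0; elim: m a => [|m IH] a ab wc cd.
  have -> : b = a by arith.
  by apply: walk_nil; rewrite mulr0.
rewrite -natr1 in ab *.
have [ab1|ab1] := leP b (a + 1).
  apply: walk_step.
    apply: le_trans (cd _ _ _ _) _; rewrite ?lexx ?andbT//=; try arith.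
    by rewrite distrC ger0_norm; arith.
  apply: le_trans (wc a _) _; first by arith.
  by rewrite mulrDr mulr1 lerDr mulr_ge0.
rewrite mulrDr mulr1 addrC; apply: (@walk_cat _ _ (c (a + 1))).
  apply: walk_step; last by apply: wc; arith.
  apply: le_trans (cd _ _ _ _) _; try arith.
  by rewrite distrC ger0_norm; arith.
apply: IH => [|s hs|s t hs ht]; first by arith.
  by apply: wc; arith.
by apply: cd; arith.
Qed.

Lemma geodesic_walk w (M : R) x y : geodesic_space d -> 0 <= M ->
  (forall z, w z <= M) -> walk w x y (M * (d x y + 1)).
Proof.
move=> geo M0 wM; have [c [c0 [c1 cd]]] := geo x y.
have := dist_ge0 x y => d0.
have := Num.Theory.truncn_itv d0 => /andP[k1 k2].
rewrite -{1}c0 -{1}c1; apply: (@walk_le _ _ _ (M * (Num.truncn (d x y)).+1%:R)).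
  apply: curve_walk => //; first by rewrite add0r d0 ltW.
  by move=> s t hs ht; rewrite cd.
by rewrite ler_wpM2l// -natr1; arith.
Qed.

(* Greedy subdivision of a rectifiable path into jumps of length between
   1/2 and 1. *)
Lemma path_walk w (p : R -> X) (L : R) : is_path d p -> path_len_le d p L ->
    (forall s, 0 <= s <= 1 -> w (p s) <= 1) ->
  walk w (p 0) (p 1) (2 * L + 1).
Proof.
move=> pc pL wp.
pose St k := exists ts : nat -> R,
  [/\ ts 0%N = 0, forall i, (i < k)%N -> ts i <= ts i.+1, 0 <= ts k <= 1,
      forall i, (i < k)%N -> 1 / 2 <= d (p (ts i)) (p (ts i.+1)) &
      walk w (p 0) (p (ts k)) k%:R].
have Stk k : St k -> k%:R <= 2 * L.
  move=> [ts [ts0 tsm tsk tsd _]].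
  (* Completing the times by 1 gives a partition of [0,1]. Each of its first [k] jumps accounts for
     at least 1/2 of the length, hence [k%:R <= 2 * L]. *)
  pose us i := if (i <= k)%N then ts i else 1.
  have := pL k.+1 us; rewrite /us /= ts0 ltnn => /(_ erefl erefl) H.
  have /H : forall i, (i < k.+1)%N ->
      (if (i <= k)%N then ts i else 1) <= (if (i < k)%N then ts i.+1 else 1).
    move=> i; rewrite ltnS => ik; rewrite ik.
    case: ltnP => [/tsm//|ki]; have -> : i = k by apply/eqP; rewrite eqn_leq ik.
    by case/andP: tsk.
  rewrite big_ord_recr /= ltnn leqnn => H1.
  have : \sum_(i < k) (1 / 2 : R) <= \sum_(i < k)
    d (p (if (i <= k)%N then ts i else 1)) (p (if (i < k)%N then ts i.+1 else 1)).
    by apply: ler_sum => i _; rewrite ltn_ord ltnW//; exact: tsd.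
  rewrite sumr_const card_ord -mulr_natr => H2.
  have := dist_ge0 (p (ts k)) (p 1); arith.
have St0 : St 0%N.
  by exists (fun=> 0); split=> //; [arith|apply: walk_nil].
have step k : St k -> St k.+1 \/ walk w (p 0) (p 1) (k%:R + 1).
  move=> [ts [ts0 tsm tsk tsd tsw]].
  (* [sup E] is the first time after [ts k] at which the path is about to leave the ball of radius
     1/2 around [p (ts k)]. If it equals 1, one last jump reaches [p 1]. *)
  pose E := [set t | ts k <= t <= 1 /\
    forall s, ts k <= s <= t -> d (p (ts k)) (p s) <= 1 / 2].
  have Ek : E (ts k).
    split; first by arith.
    by move=> s hs; have -> : s = ts k; [arith|rewrite dxx; arith].
  have Eb : has_sup E.
    by split; [exists (ts k)|exists 1 => t [/andP[]]].
  have tau0 : ts k <= sup E by exact: (ub_le_sup Eb.2 Ek).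
  have tau1 : sup E <= 1 by apply: ge_sup; [exists (ts k)|move=> t [/andP[]]].
  have tau01 : 0 <= sup E <= 1 by arith.
  have [del del0 hdel] := pc _ tau01 (1/4) ltac:(arith).
  have [t [Et1 Et2] tdel] := sup_adherent del0 Eb.
  have tE : t <= sup E by apply: (ub_le_sup Eb.2).
  have dtau : d (p (ts k)) (p (sup E)) <= 3 / 4.
    have := hdel t ltac:(arith); rewrite ger0_norm; last by arith.
    move=> /(_ ltac:(arith)); rewrite dC => h.
    have := Et2 t ltac:(arith); have := dT (p (ts k)) (p t) (p (sup E)); arith.
  have [E1|E1] := leP 1 (sup E).
    right; apply: walk_cat tsw _; apply: walk_step; last by apply: wp; arith.
    have <- : sup E = 1 by arith.
    arith.
  left.
  (* Just after [sup E] some [s] lies at distance more than 1/2. By continuity [p s] is within 1/4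
     of [p (sup E)], itself within 3/4 of [p (ts k)], so the new jump has length at most 1. *)
  pose t' := Num.min 1 (sup E + del / 2).
  have t'E : sup E < t' by rewrite /t' lt_min E1/=; arith.
  have t'1 : t' <= 1 by rewrite /t' ge_min lexx.
  have t'd : t' <= sup E + del / 2 by rewrite /t' ge_min lexx orbT.
  have [s hs sd] : exists2 s, ts k <= s <= t' & 1 / 2 < d (p (ts k)) (p s).
    apply: contrapT => hn; have : E t'.
      split; first by arith.
      by move=> s hs; rewrite leNgt; apply/negP => h; apply: hn; exists s.
    by move/(ub_le_sup Eb.2); arith.
  have sE : sup E <= s.
    rewrite leNgt; apply/negP => h.
    have [t2 [Et3 Et4] t2s] := sup_adherent (eps := sup E - s) ltac:(arith) Eb.
    have := Et4 s ltac:(arith); arith.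
  have sle1 : d (p (ts k)) (p s) <= 1.
    have := hdel s ltac:(arith); rewrite distrC ger0_norm; last by arith.
    move=> /(_ ltac:(arith)) h.
    have := dT (p (ts k)) (p (sup E)) (p s); arith.
  exists (fun i => if (i <= k)%N then ts i else s); rewrite ltnn; split=> //.
  - move=> i; rewrite ltnS => ik; rewrite ik.
    case: ltnP => [/tsm//|ki]; have -> : i = k by apply/eqP; rewrite eqn_leq ik.
    arith.
  - arith.
  - move=> i; rewrite ltnS => ik; rewrite ik.
    case: ltnP => [/tsd//|ki]; have -> : i = k by apply/eqP; rewrite eqn_leq ik.
    by rewrite ltW.
  - rewrite -natr1; apply: walk_cat tsw _; apply: walk_step => //.
    by apply: wp; arith.
(* If the greedy choice never stopped, [St k] would hold for every [k], against the bound
   [2 * L]. *)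
have [k [Sk kw]] : exists k, St k /\ walk w (p 0) (p 1) (k%:R + 1).
  apply: contrapT => hn.
  have Sall k : St k.
    by elim: k => // k IH; have [//|h] := step k IH; case: hn; exists k.
  have L0 : 0 <= 2 * L by have := Stk _ St0.
  have := Stk _ (Sall (Num.truncn (2 * L)).+1); have /andP[_] := Num.Theory.truncn_itv L0; arith.
by apply: walk_le kw _; have := Stk _ Sk; arith.
Qed.

End Walks.

(** * Redirecting one quasi-geodesic ray to another *)

Section Redirect.
Context {R : realType} {X : Type}.
Variables (d : X -> X -> R) (o : X).
Hypothesis dxx : forall x, d x x = 0.
Hypothesis dC : forall x y, d x y = d y x.
Hypothesis dT : forall x y z, d x z <= d x y + d y z.

Let d_ge0 x y : 0 <= d x y.
Proof. exact: dist_ge0. Qed.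

Let lt_or (x y : R) : x < y \/ y <= x.
Proof. by apply/orP; rewrite leNgt orbN. Qed.

(** Ordering the parameters and clearing the denominator removes absolute values and division; the
    symmetry of [d] gives back the other order. *)
Lemma qgeodP (q Q : R) (a : R -> X) : 0 < q ->
  qgeod d q Q [set t | 0 <= t] a <->
  forall s t, 0 <= s <= t ->
    t - s <= q * (d (a s) (a t) + Q) /\ d (a s) (a t) <= q * (t - s) + Q.
Proof.
move=> q0; split=> [h s t /andP[s0 st]|h].
  have t0 : 0 <= t by arith.
  have [] := h s t s0 t0; rewrite distrC ger0_norm ?subr_ge0// => h1 h2.
  by split=> //; rewrite mulrC -ler_pdivrMr//; arith.
suff H s t : 0 <= s <= t -> `|s - t| / q - Q <= d (a s) (a t) /\
    d (a s) (a t) <= q * `|s - t| + Q.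
  move=> s t /= s0 t0; have [st|ts] := leP s t; first by apply: H; arith.
  by rewrite dC distrC; apply: H; arith.
move=> st; have [h1 h2] := h _ _ st.
rewrite distrC ger0_norm; last by arith.
by split=> //; rewrite lerBlDr ler_pdivrMr// mulrC.
Qed.

Lemma qgeod_weaken (q Q q' Q' : R) I (a : R -> X) : 0 < q -> q <= q' -> Q <= Q' ->
  qgeod d q Q I a -> qgeod d q' Q' I a.
Proof.
move=> q0 qq QQ h s t Is It; have [h1 h2] := h s t Is It.
have ? : 0 <= `|s - t| by [].
split; last first.
  have := ler_wpM2r (normr_ge0 (s - t)) qq; arith.
have : `|s - t| / q' <= `|s - t| / q.
  by rewrite ler_wpM2l// lef_pV2// posrE; arith.
arith.
Qed.

(** The chain is read as a step function, one unit of time per point; quasi-geodesics need not be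
    continuous. *)
Definition splice (a b : R -> X) (z : nat -> X) (t s : R) (k : nat) (u : R) : X :=
  if u < t then a u
  else if u < t + k%:R then z (Num.truncn (u - t)) else b (u - t - k%:R + s).

(** * A near-optimal concatenation is a quasi-geodesic *)

Section Splice.
Variables (a b : R -> X) (q Q T0 S0 rho K M t s : R) (k : nat) (z : nat -> X).
Variables (w : X -> R) (q' Q' : R).
Hypothesis geo : geodesic_space d.
Hypothesis q1 : 1 <= q.
Hypothesis Q0 : 0 <= Q.
Hypothesis K0 : 0 <= K.
Hypothesis w1M : forall x, 1 <= w x <= M.
Hypothesis qa : qgeod d q Q [set t | 0 <= t] a.
Hypothesis qb : qgeod d q Q [set t | 0 <= t] b.
Hypothesis Tt : 0 <= T0 <= t.
Hypothesis Ss : 0 <= S0 <= s.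
Hypothesis z0 : z 0%N = a t.
Hypothesis zk : z k = b s.
Hypothesis zd : forall i, (i < k)%N -> d (z i) (z i.+1) <= 1.
Hypothesis opt : forall t' s' c', T0 <= t' -> S0 <= s' ->
  walk d w (a t') (b s') c' ->
  (q + 1) * t + \sum_(i < k) w (z i) - s / (2 * q) <=
  (q + 1) * t' + c' - s' / (2 * q) + 1.
Hypothesis tk : t + k%:R <= 3 * K * rho.
Hypothesis zfar : forall i, (i <= k)%N -> rho / 2 <= d o (z i).
Hypothesis aclose : forall u, 0 <= u <= T0 -> d o (a u) <= rho / 4.
Hypothesis bfar : forall u, s <= u -> rho <= d o (b u).
Hypothesis ob : d o (b 0) = 0.
(** The summand with [M] serves the shortcut estimates; the other two serve pairs whose first point
    lies on [a] before [T0]. *)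
Hypothesis hq' : 2 * q * M + 12 * K + 2 * q <= q'.
Hypothesis hQ' : 2 * Q + 3 <= Q'.

Let w1 x : 1 <= w x. Proof. by case/andP: (w1M x). Qed.
Let wM x : w x <= M. Proof. by case/andP: (w1M x). Qed.
Let M1 : 1 <= M. Proof. exact: le_trans (w1 o) (wM o). Qed.
Ltac sarith := move: q1 Q0 K0 M1 Tt Ss tk hq' hQ'; lra.

Let q0 : 0 < q. Proof. sarith. Qed.
Let B := (2 * q)^-1.
Let qB : 2 * q * B = 1. Proof. by rewrite /B divff//; sarith. Qed.
Let B0 : 0 < B. Proof. by rewrite invr_gt0; sarith. Qed.
Let sg i j := \sum_(i <= l < j) w (z l).

Let sg_walk i j : (i <= j <= k)%N -> walk d w (z i) (z j) (sg i j).
Proof.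
move=> /andP[ij jk]; have := @seq_walk _ _ d w z i (j - i).
rewrite subnKC// => h; apply: h => l /andP[il lj].
by apply: zd; apply: leq_trans lj jk.
Qed.

Let sg_ge i j : (i <= j)%N -> j%:R - i%:R <= sg i j.
Proof. exact: weight_sum_ge. Qed.

Let sg_cat i j l : (i <= j <= l)%N -> sg i l = sg i j + sg j l.
Proof. by move=> /andP[ij jl]; rewrite /sg (@big_cat_nat _ _ _ j). Qed.

Let short x y : walk d w x y (M * (d x y + 1)).
Proof. by apply: geodesic_walk => //; sarith. Qed.

Let opt' t' s' c' : T0 <= t' -> S0 <= s' -> walk d w (a t') (b s') c' ->
  (q + 1) * t + sg 0%N k - B * s <= (q + 1) * t' + c' - B * s' + 1.
Proof.
move=> h1 h2 h3; have := opt h1 h2 h3.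
by rewrite /sg big_mkord /B ![_^-1 * _]mulrC.
Qed.

Let detour_cost u : u <= t -> t - u <= (q + 1) * (t - u).
Proof. by move=> ut; rewrite mulrDl mul1r lerDr mulr_ge0; sarith. Qed.

(** Replace [a] on [u,t] and the first [i] steps of the chain by a geodesic walk: near-minimality
    bounds the saving by the price of that walk plus 1. The next three estimates cut out other
    pieces in the same way; moving the entry into [b] from [s] to [v] gains [B * (v - s)]. *)
Let shortcut_az u i : T0 <= u <= t -> (i <= k)%N ->
  t - u + i%:R <= M * (d (a u) (z i) + 1) + 1.
Proof.
move=> /andP[Tu ut] ik.
have := walk_cat (short (a u) (z i)) (sg_walk (i := i) (j := k) _).
rewrite ik leqnn zk => /(_ isT) /(opt' Tu) => /(_ ltac:(sarith)).
rewrite (@sg_cat 0%N i k) ?ik//.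
have := sg_ge (leq0n i); have := detour_cost ut; sarith.
Qed.

Let shortcut_ab u v : T0 <= u <= t -> s <= v ->
  t - u + k%:R + B * (v - s) <= M * (d (a u) (b v) + 1) + 1.
Proof.
move=> /andP[Tu ut] sv.
have := short (a u) (b v) => /(opt' Tu) => /(_ ltac:(sarith)).
have := sg_ge (leq0n k); have := detour_cost ut; sarith.
Qed.

Let shortcut_zz i j : (i <= j <= k)%N ->
  j%:R - i%:R <= M * (d (z i) (z j) + 1) + 1.
Proof.
move=> /andP[ij jk]; have ik := leq_trans ij jk.
have h1 := walk_cat (@sg_walk 0%N i ik) (short (z i) (z j)).
have h2 : walk d w (z j) (b s) (sg j k) by rewrite -zk; apply: sg_walk; rewrite jk /=.
have := walk_cat h1 h2; rewrite z0 => /opt' => /(_ ltac:(sarith) ltac:(sarith)).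
rewrite (@sg_cat 0%N i k) ?ik// (@sg_cat i j k) ?ij//; have := sg_ge ij; sarith.
Qed.

Let shortcut_zb i v : (i <= k)%N -> s <= v ->
  k%:R - i%:R + B * (v - s) <= M * (d (z i) (b v) + 1) + 1.
Proof.
move=> ik sv; have := walk_cat (@sg_walk 0%N i ik) (short (z i) (b v)).
rewrite z0 => /opt' => /(_ ltac:(sarith) ltac:(sarith)).
rewrite (@sg_cat 0%N i k) ?ik//; have := sg_ge ik; sarith.
Qed.

Let z_lip i j : (i <= j <= k)%N -> d (z i) (z j) <= j%:R - i%:R.
Proof. by move=> /andP[ij jk]; exact: (chain_dist dxx dT zd). Qed.

Local Notation g := (splice a b z t s k).

Let splice_a u : u < t -> g u = a u.
Proof. by rewrite /splice => ->. Qed.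

Let splice_b u : t + k%:R <= u -> g u = b (u - t - k%:R + s).
Proof.
move=> h; have k0 : (0 : R) <= k%:R by [].
by rewrite /splice !ltNge h (_ : t <= u)//; sarith.
Qed.

Let splice_z u : t <= u -> u < t + k%:R -> exists i : nat,
  [/\ g u = z i, (i < k)%N & i%:R <= u - t < i%:R + 1].
Proof.
move=> tu utk; exists (Num.truncn (u - t)).
have := Num.Theory.truncn_itv (x := u - t) ltac:(sarith); rewrite -natr1 => /andP[h1 h2].
split; last by rewrite h1.
  by rewrite /splice ltNge tu utk.
by rewrite -(ltr_nat R); sarith.
Qed.

Let scale x y D : 0 <= D -> 0 <= x <= q' -> 0 <= y <= Q' ->
  x * (D + y) <= q' * (D + Q').
Proof. by move=> D0 /andP[? ?] /andP[? ?]; apply: ler_pM => //; sarith. Qed.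

Let qM : q <= q * M. Proof. by rewrite ler_peMr//; sarith. Qed.

(** Multiplying by [2 * q] turns [B * y] into [y], and [1 <= M] absorbs the additive 2 into
    [M * (D + 3)]. *)
Let shortcut_scale D x y : 0 <= D -> 0 <= x -> 0 <= y ->
  x + B * y <= M * (D + 1) + 2 -> x + y <= q' * (D + Q').
Proof.
move=> D0 x0 y0 h; have := qM => qM_.
apply: (@le_trans _ _ (2 * q * M * (D + 3))); last first.
  by apply: scale => //; sarith.
have : 2 * q * (x + B * y) <= 2 * q * (M * (D + 1) + 2) by rewrite ler_wpM2l//; sarith.
rewrite mulrDr (mulrA _ B) qB mul1r.
have : 0 <= x * (q - 1) by rewrite mulr_ge0//; sarith.
sarith.
Qed.

Let qaP := (qgeodP Q a q0).1 qa.
Let qbP := (qgeodP Q b q0).1 qb.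

(** For [u < T0] the two points are at least [rho / 4] apart, while the elapsed time is at most
    [t + k%:R <= 3 * K * rho]; this gives the factor [12 * K]. *)
Let lower_az u v j : 0 <= u -> u < t -> t <= v -> (j < k)%N ->
  j%:R <= v - t < j%:R + 1 -> v - u <= q' * (d (a u) (z j) + Q').
Proof.
move=> u0 ut tv jk jv; have [uT|Tu] := lt_or u T0; last first.
  rewrite -[leLHS]addr0; apply: shortcut_scale => //; first by sarith.
  have := @shortcut_az u j ltac:(sarith) (ltnW jk); sarith.
have jk1 : j.+1%:R <= k%:R :> R by rewrite ler_nat.
have qM_ := qM.
apply: (@le_trans _ _ (12 * K * (d (a u) (z j) + 0))); last by apply: scale => //; sarith.
have h1 := zfar (ltnW jk); have h2 := @aclose u ltac:(sarith); have h3 := dT o (a u) (z j).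
have : 12 * K * (rho / 4) <= 12 * K * d (a u) (z j) by apply: ler_wpM2l; sarith.
rewrite -natr1 in jk1; sarith.
Qed.

(** For [u < T0] the distance D between the points is at least [rho / 2], which pays for [t + k%:R]
    with factor [6 * K]. Moreover [b v] is at distance at most 2 D from the base point, so the time
    spent on [b] costs at most [q * (2 * D + Q)]. *)
Let lower_ab u v : 0 <= u -> u < t -> s <= v ->
  t - u + k%:R + (v - s) <= q' * (d (a u) (b v) + Q').
Proof.
move=> u0 ut sv; have k0 : (0 : R) <= k%:R by [].
have [uT|Tu] := lt_or u T0; last first.
  apply: shortcut_scale => //; try sarith.
  have := @shortcut_ab u v ltac:(sarith) sv; sarith.
have qM_ := qM.
apply: (@le_trans _ _ ((6 * K + 2 * q) * (d (a u) (b v) + Q))); last first.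
  by apply: scale => //; sarith.
have [h1 _] := @qbP 0 v ltac:(sarith).
have h2 := dT (b 0) o (b v); rewrite (dC (b 0) o) ob in h2.
have h6 := d_ge0 o (a u); have h3 := bfar sv; have h4 := @aclose u ltac:(sarith); have h5 := dT o (a u) (b v).
have : 6 * K * (rho / 2) <= 6 * K * d (a u) (b v) by apply: ler_wpM2l; sarith.
have : q * (d (b 0) (b v) + Q) <= q * (2 * d (a u) (b v) + Q).
  by apply: ler_wpM2l; sarith.
have : 0 <= K * Q by rewrite mulr_ge0.
have : 0 <= q * Q by apply: mulr_ge0; sarith.
sarith.
Qed.

Let splice_lower u v : 0 <= u <= v -> v - u <= q' * (d (g u) (g v) + Q').
Proof.
move=> /andP[u0 uv]; have k0 : (0 : R) <= k%:R by [].
have scale_q x : 0 <= x -> q * (x + Q) <= q' * (x + Q').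
  by move=> x0; have qM_ := qM; apply: scale => //; sarith.
have [ut|tu] := lt_or u t; have [vt|tv] := lt_or v t.
- by rewrite !splice_a//; apply: le_trans (scale_q _ _) => //; case: (@qaP u v); sarith.
- rewrite (splice_a ut); have [vk|kv] := lt_or v (t + k%:R).
    by have [j [-> jk jv]] := splice_z tv vk; exact: lower_az.
  rewrite splice_b//.
  have -> : v - u = t - u + k%:R + (v - t - k%:R + s - s) by ring.
  by apply: lower_ab => //; sarith.
- by exfalso; sarith.
- have [uk|ku] := lt_or u (t + k%:R); have [vk|kv] := lt_or v (t + k%:R).
  + have [i [-> ik iu]] := splice_z tu uk.
    have [j [-> jk jv]] := splice_z tv vk.
    have ij : (i <= j)%N by rewrite -ltnS -(ltr_nat R) -natr1; sarith.
    rewrite -[leLHS]addr0; apply: shortcut_scale => //; first by sarith.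
    have := @shortcut_zz i j ltac:(by rewrite ij ltnW); sarith.
  + have [i [-> ik iu]] := splice_z tu uk; rewrite splice_b//.
    have -> : v - u = t + k%:R - u + (v - t - k%:R + s - s) by ring.
    apply: shortcut_scale => //; try sarith.
    have := @shortcut_zb i (v - t - k%:R + s) (ltnW ik) ltac:(sarith); sarith.
  + by exfalso; sarith.
  + rewrite !splice_b//.
    have -> : v - u = (v - t - k%:R + s) - (u - t - k%:R + s) by ring.
    apply: le_trans (scale_q _ _) => //.
    by case: (@qbP (u - t - k%:R + s) (v - t - k%:R + s)); sarith.
Qed.

(** Each of the two rays contributes one [Q]; the 1 comes from rounding times down along the
    chain. *)
Let splice_upper u v : 0 <= u <= v -> d (g u) (g v) <= q * (v - u) + (2 * Q + 1).
Proof.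
move=> /andP[u0 uv]; have k0 : (0 : R) <= k%:R by [].
have qm y : 0 <= y -> y <= q * y by move=> y0; rewrite ler_peMl.
have qmuv := qm (v - u) ltac:(sarith).
have [ut|tu] := lt_or u t; have [vt|tv] := lt_or v t.
- by rewrite !splice_a//; case: (@qaP u v); sarith.
- rewrite (splice_a ut); have [_ h1] := @qaP u t ltac:(sarith).
  have qmt := qm (v - t) ltac:(sarith).
  have [vk|kv] := lt_or v (t + k%:R).
    have [j [-> jk jv]] := splice_z tv vk.
    have := @z_lip 0%N j (ltnW jk).
    have := dT (a u) (a t) (z j); rewrite z0; sarith.
  rewrite splice_b//; have := @z_lip 0%N k (leqnn k); rewrite z0 zk.
  have := qm k%:R k0.
  have [_] := @qbP s (v - t - k%:R + s) ltac:(sarith).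
  have := dT (a u) (a t) (b (v - t - k%:R + s)).
  have := dT (a t) (b s) (b (v - t - k%:R + s)); sarith.
- by exfalso; sarith.
- have [uk|ku] := lt_or u (t + k%:R); have [vk|kv] := lt_or v (t + k%:R).
  + have [i [-> ik iu]] := splice_z tu uk.
    have [j [-> jk jv]] := splice_z tv vk.
    have ij : (i <= j)%N by rewrite -ltnS -(ltr_nat R) -natr1; sarith.
    have := @z_lip i j ltac:(by rewrite ij ltnW); sarith.
  + have [i [-> ik iu]] := splice_z tu uk; rewrite splice_b//.
    have := @z_lip i k ltac:(by rewrite leqnn ltnW); rewrite zk.
    have [_] := @qbP s (v - t - k%:R + s) ltac:(sarith).
    have := qm (t + k%:R - u) ltac:(sarith).
    have := dT (z i) (b s) (b (v - t - k%:R + s)); sarith.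
  + by exfalso; sarith.
  + rewrite !splice_b//.
    by case: (@qbP (u - t - k%:R + s) (v - t - k%:R + s)); sarith.
Qed.

(* If (t, z, s) minimises (q + 1) t + cost z - s / (2 q) up to an error of 1,
   shortcuts between points of the spliced ray at parameters at least T0 gain
   only a bounded amount; the part of a before T0 stays deep inside the ball of
   radius rho / 2, which the rest avoids. *)
Lemma splice_qgeod : qgeod d q' Q' [set t | 0 <= t] g.
Proof.
have qM_ := qM.
apply/qgeodP; first by sarith.
move=> u v uv; split; first exact: splice_lower.
have := splice_upper uv.
have : q * (v - u) <= q' * (v - u) by apply: ler_wpM2r; sarith.
sarith.
Qed.

End Splice.

(** * Competitors, near-minimisers and their distance from the base point *)

Lemma qray_norm (q Q t : R) (a : R -> X) : 1 <= q -> qray d o q Q a -> 0 <= t ->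
  t <= q * (d o (a t) + Q) /\ d o (a t) <= q * t + Q.
Proof.
move=> q1 [a0 qa] t0; have q0 : 0 < q by arith.
have := (qgeodP Q a q0).1 qa 0 t; rewrite lexx t0 a0 subr0; exact.
Qed.

Lemma truncn_bound (x : R) : 0 <= x -> x <= (Num.truncn x).+1%:R <= x + 1.
Proof.
move=> x0; have /andP[h1 h2] := Num.Theory.truncn_itv x0.
by rewrite (ltW h2) -natr1 lerD2r.
Qed.

(** Follow the outer part of a geodesic from [o] to [x]. Both directions are recorded because a step
    is charged at the point it leaves, so walks cannot simply be reversed. *)
Lemma radial_walk w (r : R) x : geodesic_space d -> 0 <= r <= d o x ->
    (forall y, r <= d o y -> w y <= 1) ->
  exists2 y, d o y = r & walk d w y x (d o x + 1) /\ walk d w x y (d o x + 1).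
Proof.
move=> geo rx wr; have [c [c0 [c1 cd]]] := geo o x.
have cn s : 0 <= s <= d o x -> d o (c s) = s.
  move=> hs; rewrite -{1}c0 cd//; last by arith.
  by rewrite sub0r normrN ger0_norm; arith.
have x0 : 0 <= d o x by arith.
have /andP[k1 k2] := truncn_bound x0; set k := (Num.truncn _).+1 in k1 k2.
exists (c r); first by apply: cn.
rewrite -[X in walk d w _ X]c1 -[X in _ /\ walk d w X _ _]c1; split.
  apply: (@walk_le _ _ _ _ _ _ k%:R) => //; rewrite -[k%:R]mul1r.
  apply: curve_walk => //; first by arith.
    by move=> s hs; apply: wr; rewrite cn; arith.
  by move=> s t hs ht; rewrite cd//; arith.
apply: (@walk_le _ _ _ _ _ _ k%:R) => //; rewrite -[k%:R]mul1r.
have := @curve_walk _ _ d w 1 (fun s => c (d o x - s)) k 0 (d o x - r).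
rewrite /= subr0 subKr; apply => //; first by arith.
  by move=> s hs; apply: wr; rewrite cn; arith.
move=> s t hs ht; rewrite cd//; try arith.
by have -> : d o x - s - (d o x - t) = t - s by [ring]; rewrite distrC.
Qed.

Lemma walk_ge w x y c : (forall x, 1 <= w x) -> walk d w x y c -> d x y <= c.
Proof.
move=> w1; elim=> [{}x {}c c0|{}x x' {}y {}c c' xx' _ IH wc]; first by rewrite dxx.
have := dT x x' y; have := w1 x; arith.
Qed.

(** Every step costs at least 1. From [z i] the chain needs at least [rho - d o (z i)] steps to
    climb out of the ball, and each of these costs an extra [M]. *)
Lemma chain_cost w (rho M : R) (z : nat -> X) i k : 0 <= M ->
    (forall x, w x = if d o x < rho then M + 1 else 1) ->
    (forall l, (l < k)%N -> d (z l) (z l.+1) <= 1) -> (i <= k)%N ->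
    rho <= d o (z k) ->
  k%:R + M * (rho - d o (z i)) <= \sum_(l < k) w (z l).
Proof.
move=> M0 wE zd ik zk; have w1 x : 1 <= w x by rewrite wE; case: ifP => _; arith.
have sum1 m n : (m <= n)%N -> n%:R - m%:R <= \sum_(m <= l < n) w (z l).
  exact: weight_sum_ge.
rewrite -(big_mkord predT (fun l => w (z l))) (@big_cat_nat _ _ _ i)//=.
suff : k%:R - i%:R + M * (rho - d o (z i)) <= \sum_(i <= l < k) w (z l).
  by have := sum1 0%N i isT; rewrite subr0; arith.
have [n] := ubnP (k - i); elim: n i ik => // n IH i ik kin.
have [h|h] := boolP (d o (z i) < rho); last first.
  have h1 : M * (rho - d o (z i)) <= 0.
    by rewrite mulr_ge0_le0// subr_le0 leNgt.
  have := sum1 i k ik; arith.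
have {}ik : (i < k)%N.
  rewrite ltn_neqAle ik andbT; apply: contraTneq h => ->.
  by rewrite -leNgt.
rewrite big_ltn// wE h; have := IH i.+1 ik ltac:(lia).
have : M * (d o (z i.+1) - d o (z i)) <= M * 1.
  apply: ler_wpM2l => //; have := dT o (z i) (z i.+1); have := zd _ ik; arith.
rewrite -(natr1 i); arith.
Qed.

(** At time [T] both maps are already outside the ball, so no time beyond [T] is tested. *)
Lemma restr_eq_prefix (r T : R) (g a : R -> X) : 0 <= T -> r < d o (a T) ->
  (forall u, 0 <= u <= T -> g u = a u) -> restr_eq d o r g a.
Proof.
move=> T0 aT ga; split=> t t0 h; have [tT|Tt] := leP t T; rewrite ?ga ?t0//.
  by have := h T; rewrite T0 Tt => /(_ isT); arith.
by have := h T; rewrite T0 Tt ga ?T0 ?lexx// => /(_ isT); arith.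
Qed.

(** The infimum of the objective over real parameters need not be attained; a value within 1 of it
    is enough. *)
Lemma near_optimal w (A B L T0 S0 t0 s0 c0 : R) (a b : R -> X) :
    T0 <= t0 -> S0 <= s0 -> walk d w (a t0) (b s0) c0 ->
    (forall t s c, T0 <= t -> S0 <= s -> walk d w (a t) (b s) c ->
      L <= A * t + c - B * s) ->
  exists t s k (z : nat -> X),
  [/\ T0 <= t /\ S0 <= s, z 0%N = a t /\ z k = b s,
      forall i, (i < k)%N -> d (z i) (z i.+1) <= 1 &
      forall t' s' c', T0 <= t' -> S0 <= s' -> walk d w (a t') (b s') c' ->
        A * t + \sum_(i < k) w (z i) - B * s <= A * t' + c' - B * s' + 1].
Proof.
move=> Tt0 Ss0 w0 lb.
pose E := [set v | exists t s c, [/\ T0 <= t, S0 <= s, walk d w (a t) (b s) c &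
   v = A * t + c - B * s]].
have Ei : has_inf E.
  split; first by exists (A * t0 + c0 - B * s0), t0, s0, c0.
  by exists L => v [t [s [c [h1 h2 h3 ->]]]]; exact: lb.
have [_ [t [s [c [h1 h2 h3 ->]]]] hc] := inf_adherent ltr01 Ei.
have [k [z [z0 zk zd zw]]] := walk_seq h3.
exists t, s, k, z; split=> // t' s' c' h1' h2' h3'.
have : inf E <= A * t' + c' - B * s'.
  by apply: (ge_inf Ei.2); exists t', s', c'.
arith.
Qed.

Definition divergence_le (C : R) : Prop :=
  forall r, 1 < r -> forall x y, d o x = r -> d o y = r ->
    exists p, is_path d p /\ p 0 = x /\ p 1 = y /\ path_len_le d p (C * r) /\
      forall s, 0 <= s <= 1 -> r / 2 - 2 <= d o (p s).

(** Move radially to the sphere of radius [r = 2 * rho + 4] and join there by linear divergence. The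
    radius is chosen so that [r / 2 - 2 = rho]: the joining path stays where the weight is at most
    1. *)
Lemma outer_walk w (C rho : R) x y : geodesic_space d -> 0 < C ->
    divergence_le C ->
    (forall z, rho <= d o z -> w z <= 1) -> 0 <= rho ->
    2 * rho + 4 <= d o x -> 2 * rho + 4 <= d o y ->
  walk d w x y (d o x + d o y + 2 * C * (2 * rho + 4) + 3).
Proof.
move=> geo C0 div wrho rho0 hx hy; set r := 2 * rho + 4 in hx hy *.
have wr z : r <= d o z -> w z <= 1 by move=> h; apply: wrho; rewrite /r in h; arith.
have rx : 0 <= r <= d o x by rewrite hx /r; arith.
have ry : 0 <= r <= d o y by rewrite hy /r; arith.
have [x' x'r [_ xx']] := radial_walk geo rx wr.
have [y' y'r [yy' _]] := radial_walk geo ry wr.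
have [p [pc [p0 [p1 [pl po]]]]] := div r ltac:(rewrite /r; arith) _ _ x'r y'r.
have := @path_walk _ _ d dxx dC dT w p _ pc pl; rewrite p0 p1.
have wp s : 0 <= s <= 1 -> w (p s) <= 1.
  by move=> hs; apply: wrho; have := po s hs; rewrite /r; arith.
move=> /(_ wp) h; apply: walk_le (walk_cat (walk_cat xx' h) yy') _.
arith.
Qed.

(** The factor [N] depends on [q] and [C] alone, so the weight inside the ball may be chosen after
    it. *)
Lemma competitor_cost (q Q C rho S0 N A0 : R) : 1 <= q -> 0 <= Q ->
    4 <= rho -> 4 * Q <= rho -> 0 < C ->
    N = 16 * q ^+ 2 + 6 * C + 2 -> S0 = q * (2 * rho + 4 + Q) ->
    A0 <= q * S0 + Q ->
    (q + 1) * S0 + (2 * A0 + 2 * C * (2 * rho + 4) + 3) + 1 <= N * rho.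
Proof.
move=> q1 Q0 rho4 Qrho C0 -> -> hA.
have h1 : q * (2 * rho + 4 + Q) <= q * (4 * rho) by apply: ler_wpM2l; arith.
have h2 : q * (q * (2 * rho + 4 + Q)) <= q * (q * (4 * rho)) by apply: ler_wpM2l; arith.
have h3 : C * (2 * rho + 4) <= C * (3 * rho) by apply: ler_wpM2l; arith.
have h4 : 0 <= (q - 1) * (q * rho) by rewrite mulr_ge0//; [arith|rewrite mulr_ge0; arith].
rewrite expr2; arith.
Qed.

(** Here [b] stands for [s / (2 * q)], [l] for the distance of the endpoints and [c] for the cost of
    the chain. The lower bound on the objective already holds with [l <= k] in place of [c], so the
    excess [c - k] is at most [N * rho + 2 * Q]; this limits the depth [h] to which the chain enters
    the ball. *)
Lemma optimum_bounds (q Q rho N t b l k c : R) : 0 <= q * t -> 0 <= Q ->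
    0 <= rho -> 4 * Q <= rho -> 0 <= N * rho -> 0 <= t -> 0 <= b ->
    t + b - 2 * Q <= (q + 1) * t + l - b -> l <= k -> k <= c ->
    (q + 1) * t + c - b <= N * rho ->
  t + k <= 3 * (N + 2) * rho /\
  forall h, k + 2 * (N + 2) * h <= c -> (N + 2) * h <= (N + 2) * (rho / 2).
Proof. by move=> *; split=> [|h ?]; arith. Qed.

(** The constants are fixed before [r]. The time shift [c] may still be negative here. *)
Lemma weak_redirect (C q Q : R) (a b : R -> X) : geodesic_space d -> 0 < C ->
    divergence_le C ->
    1 <= q -> 0 <= Q -> qray d o q Q a -> qray d o q Q b ->
  exists q' Q' : R, 1 <= q' /\ 0 <= Q' /\ forall r, 0 < r ->
    exists g (c tg T : R), [/\ qray d o q' Q' g, 0 <= T /\ r < d o (a T),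
      forall t, 0 <= t <= T -> g t = a t & forall t, tg <= t -> 0 <= t + c /\ g t = b (t + c)].
Proof.
move=> geo C0 div q1 Q0 qa qb.
pose N := 16 * q ^+ 2 + 6 * C + 2.
have N0 : 2 <= N.
  have : 0 <= q ^+ 2 by rewrite exprn_ge0//; arith.
  by rewrite /N; arith.
(* The competitor costs at most N rho; M makes entering the ball of radius
   rho / 2 more expensive than that. *)
pose K := N + 2; pose M := 2 * K + 1.
have qM0 : 0 <= q * M by rewrite mulr_ge0 /M /K; arith.
exists (2 * q * M + 12 * K + 2 * q), (2 * Q + 3).
split; first by rewrite /K; arith.
split; first by arith.
move=> r r0.
(* By time [T] the ray [a] is outside the ball of radius [r]; up to [T0] it stays within [rho / 4];
   from [S0] on both rays are beyond [2 * rho + 4]. The extra 1 in [T0] keeps [T] strictly before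
   the switching time [t]. *)
pose T := q * (r + Q + 1); pose T0 := T + 1.
have Tge : r + Q + 1 <= T by rewrite /T ler_peMl//; arith.
pose rho := 4 * (q * T0 + Q).
have T0r : r + Q + 2 <= T0 by rewrite /T0; arith.
have T0ge : T0 <= q * T0 by rewrite ler_peMl//; arith.
have rho4 : 4 <= rho by rewrite /rho; arith.
have rhoQ : 4 * Q <= rho by rewrite /rho; arith.
pose S0 := q * (2 * rho + 4 + Q).
have S0ge : 2 * rho + 4 + Q <= S0 by rewrite /S0 ler_peMl//; arith.
have T_ge0 : 0 <= T by arith.
have T0_ge0 : 0 <= T0 by arith.
have q_ge0 : 0 <= q by arith.
have rho_ge0 : 0 <= rho by arith.
have S0_ge0 : 0 <= S0 by arith.
have K0 : 0 < K by rewrite /K; arith.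
have Nr : 0 <= N * rho by apply: mulr_ge0; arith.
have aT : r + 1 <= d o (a T).
  have [h _] := qray_norm q1 qa T_ge0; rewrite ler_pM2l in h; arith.
have rhoT : T0 <= rho by rewrite /rho; arith.
pose w x := if d o x < rho then 2 * K + 1 else 1.
have w1M x : 1 <= w x <= M.
  by rewrite /w /M /K; case: ifP => _; arith.
have w1 x : 1 <= w x by case/andP: (w1M x).
have na := qray_norm q1 qa; have nb := qray_norm q1 qb.
have far c s : qray d o q Q c -> S0 <= s -> 2 * rho + 4 <= d o (c s).
  move=> qc hs; have s0 : 0 <= s by arith.
  have [h _] := qray_norm q1 qc s0.
  have : q * (2 * rho + 4 + Q) <= q * (d o (c s) + Q) by apply: le_trans h.
  by rewrite ler_pM2l; arith.
pose B := (2 * q)^-1.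
have qB : 2 * q * B = 1 by rewrite /B divff//; arith.
have B0 : 0 < B by rewrite invr_gt0; arith.
have B_ge0 := ltW B0.
have divB x : x / (2 * q) = B * x by rewrite mulrC.
have bge s : 0 <= s -> 2 * B * s <= d o (b s) + Q.
  move=> s0; have [h _] := nb s s0.
  have : 2 * B * s <= 2 * B * (q * (d o (b s) + Q)) by apply: ler_wpM2l; arith.
  have -> : 2 * B * (q * (d o (b s) + Q)) = (2 * q * B) * (d o (b s) + Q) by ring.
  by rewrite qB mul1r.
have wout z : rho <= d o z -> w z <= 1 by rewrite /w ltNge => ->.
have w0 := outer_walk geo C0 div wout (ltac:(arith) : 0 <= rho)
  (far _ _ qa (lexx S0)) (far _ _ qb (lexx S0)).
(* The distance from [a t] to [b s] is at least [2 * B * s - Q - (q * t + Q)]. Hence the slope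
   [q + 1] leaves a full [t], and rewarding only half the minimal speed of [b] leaves [B * s]. *)
have lower t s : T0 <= t -> S0 <= s ->
    t + B * s - 2 * Q <= (q + 1) * t + d (a t) (b s) - B * s.
  move=> ht hs; have h1 := bge s ltac:(arith); have [_ h2] := na t ltac:(arith).
  have := dT o (a t) (b s); arith.
have w0' : walk d w (a S0) (b S0)
    (2 * (q * S0 + Q) + 2 * C * (2 * rho + 4) + 3).
  apply: walk_le w0 _; have [_ h1] := na S0 ltac:(arith); have [_ h2] := nb S0 ltac:(arith).
  arith.
have lb t s c : T0 <= t -> S0 <= s -> walk d w (a t) (b s) c ->
    - (2 * Q) <= (q + 1) * t + c - B * s.
  move=> ht hs /(walk_ge w1) hc; have := lower t s ht hs.
  have : 0 <= B * s by apply: mulr_ge0; arith.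
  arith.
have TS0 : T0 <= S0 by arith.
have [t [s [k [z [[Tt Ss] [z0 zk] zd opt]]]]] := near_optimal TS0 (lexx S0) w0' lb.
set sg := \sum_(i < k) w (z i) in opt.
have opt0 : (q + 1) * t + sg - B * s <= N * rho.
  apply: le_trans (opt _ _ _ TS0 (lexx S0) w0') _.
  have := competitor_cost q1 Q0 rho4 rhoQ C0 (erefl N) (erefl S0) (lexx _).
  have : 0 <= B * S0 by apply: mulr_ge0; arith.
  arith.
have bs := far b s qb Ss.
have k_sg : k%:R <= sg.
  have w1s : \sum_(i < k) 1 <= sg by apply: ler_sum => i _.
  by rewrite sumr_const card_ord in w1s.
have dk : d (a t) (b s) <= k%:R.
  have := chain_dist dxx dT zd (leq0n k) (leqnn k).
  by rewrite z0 zk subr0.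
have t0 : 0 <= t by arith.
have [tk hfar] : _ /\ _ := optimum_bounds (mulr_ge0 q_ge0 t0) Q0 rho_ge0 rhoQ
  Nr t0 (mulr_ge0 B_ge0 (le_trans S0_ge0 Ss)) (lower t s Tt Ss) dk k_sg opt0.
(* The weight exceeds 1 by [2 * K] inside the ball, so a depth of more than [rho / 2] would cost
   more than the excess [K * rho] allowed. *)
have zfar i : (i <= k)%N -> rho / 2 <= d o (z i).
  move=> ik; suff : K * (rho - d o (z i)) <= K * (rho / 2).
    by rewrite ler_pM2l//; arith.
  apply: hfar; apply: (chain_cost (rho := rho)) => //.
    arith.
  by rewrite zk; apply: le_trans bs; arith.
have T_lt : T < t by rewrite /T0 in Tt; arith.
pose g := splice a b z t s k.
have gq : qgeod d (2 * q * M + 12 * K + 2 * q) (2 * Q + 3) [set t | 0 <= t] g.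
  apply: (@splice_qgeod a b q Q T0 S0 rho K M t s k z w _ _ geo q1 Q0) => //.
  - exact: ltW.
  - by case: qa.
  - by case: qb.
  - by rewrite T0_ge0.
  - by rewrite S0_ge0.
  - by move=> t' s' c' h1 h2 h3; rewrite !divB; exact: opt.
  - move=> u /andP[u0 uT]; have [_ h] := na u u0.
    have := ler_wpM2l q_ge0 uT; rewrite /rho; arith.
  - by move=> u hu; have := far b u qb (le_trans Ss hu); arith.
  - by case: qb => -> _; rewrite dxx.
have ga u : u < t -> g u = a u by rewrite /g /splice => ->.
exists g, (s - t - k%:R), (t + k%:R), T; split.
- split=> //; rewrite ga; first by case: qa.
  exact: le_lt_trans T_lt.
- by split=> //; apply: lt_le_trans aT; arith.
- by move=> u /andP[_ uT]; apply: ga; apply: le_lt_trans uT T_lt.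
- move=> u hu; split; first by arith.
  rewrite /g /splice !ltNge hu (_ : t <= u) /=; last first.
    by have : (0 : R) <= k%:R by []; arith.
  by congr b; ring.
Qed.

(** * Positive time shifts and the comparison of any two rays *)

Definition slow_after (t1 t : R) : R := if t <= t1 then t else t1 + (t - t1) / 2.

Lemma slow_after_bounds t1 s t : 0 <= t1 -> 0 <= s <= t ->
  0 <= slow_after t1 s <= slow_after t1 t /\
  (t - s) / 2 <= slow_after t1 t - slow_after t1 s <= t - s.
Proof.
move=> t10 st.
have E x : x <= t1 /\ slow_after t1 x = x \/
    t1 < x /\ slow_after t1 x = t1 + (x - t1) / 2.
  by rewrite /slow_after; case: (leP x t1) => h; [left|right].
by have [[? ->]|[? ->]] := E s; have [[? ->]|[? ->]] := E t; split; arith.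
Qed.

(* [ev_coincide] asks for a positive time shift: redirect to the faster ray
   t |-> b (2 t) and slow down late enough. *)
Lemma qr_le_total (C : R) (a b : R -> X) : geodesic_space d -> 0 < C ->
    divergence_le C ->
  is_qray d o a -> is_qray d o b -> qr_le d o a b.
Proof.
move=> geo C0 div [q1 [Q1 [q11 [Q10 [a0 qa]]]]] [q2 [Q2 [q21 [Q20 [b0 qb]]]]].
pose q := 2 * (q1 + q2); pose Q := Q1 + Q2.
have qle1 : 1 <= q by rewrite /q; arith.
have Q0 : 0 <= Q by rewrite /Q; arith.
have ra : qray d o q Q a.
  by split=> //; apply: qgeod_weaken qa; rewrite /q /Q; arith.
have rb : qray d o q Q (fun t => b (2 * t)).
  split; first by rewrite mulr0.
  have q20 : 0 < q2 by arith.
  apply/qgeodP; first by arith.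
  move=> s t st.
  have [h1 h2] := (qgeodP Q2 b q20).1 qb (2 * s) (2 * t) ltac:(arith).
  have := d_ge0 (b (2 * s)) (b (2 * t)) => D0.
  split.
    have : q2 * (d (b (2 * s)) (b (2 * t)) + Q2) <= q * (d (b (2 * s)) (b (2 * t)) + Q).
      by apply: ler_pM; rewrite /q /Q; arith.
    arith.
  have : 0 <= q1 * (t - s) by apply: mulr_ge0; arith.
  by rewrite /q /Q; arith.
have [q' [Q' [q'1 [Q'0 redir]]]] := weak_redirect geo C0 div qle1 Q0 ra rb.
exists (2 * q'), Q'; split; first by arith.
split=> // r r0; have [g [c [tg [T [[g0 gq] [T0 aT] ga gb]]]]] := redir r r0.
(* Slowing down starts after [T], to keep the common prefix, and after [tg], when [g] already
   follows its target; [2 * |c|] makes the final shift [t1 + 2 * c] positive. *)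
pose t1 := `|tg| + T + 2 * `|c| + 1.
have tg0 := normr_ge0 tg; have c0 := normr_ge0 c.
have tgn := ler_norm tg; have cn := ler_norm (- c); rewrite normrN in cn.
have t10 : 0 <= t1 by rewrite /t1; arith.
exists (fun t => g (slow_after t1 t)); split; [split|split].
- by rewrite /slow_after ifT // /t1; arith.
- apply/qgeodP; first by arith.
  move=> s t st; have [st1 st2] := slow_after_bounds t10 st.
  have q'0 : 0 < q' by arith.
  have [h1 h2] := (qgeodP Q' g q'0).1 gq _ _ st1.
  split; first by arith.
  have : q' * (slow_after t1 t - slow_after t1 s) <= q' * (t - s) by apply: ler_wpM2l; arith.
  have : 0 <= q' * (t - s) by apply: mulr_ge0; arith.
  arith.
- apply: (restr_eq_prefix T0 aT) => u hu; rewrite /slow_after ifT; first by apply: ga.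
  by rewrite /t1; arith.
(* Halved time and doubled speed cancel: [2 * (t1 + (t - t1) / 2 + c) = t + (t1 + 2 * c)]. *)
- exists (t1 + 2 * c), (t1 + 1); split; first by rewrite /t1; arith.
  split; first by rewrite /t1; arith.
  move=> t ht; rewrite /slow_after ifF; last by apply/negP; arith.
  have [|_ ->] := gb (t1 + (t - t1) / 2); first by rewrite /t1 in ht *; arith.
  by congr b; field.
Qed.

End Redirect.

(** * Geodesics from concatenated 1-Lipschitz curves *)

Section LipschitzCurves.
Context {R : realType} {X : Type}.
Variable d : X -> X -> R.
Hypothesis dC : forall x y, d x y = d y x.
Hypothesis dT : forall x y z, d x z <= d x y + d y z.

Definition lip_curve x y (L : R) := exists c : R -> X,
  [/\ c 0 = x, c L = y &
      forall s t, 0 <= s -> s <= t -> t <= L -> d (c s) (c t) <= t - s].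

Lemma lip_curve_sym x y L : lip_curve x y L -> lip_curve y x L.
Proof.
move=> [c [c0 cL cd]]; exists (fun s => c (L - s)); rewrite subr0 subrr.
split=> // s t s0 st tL; rewrite dC (le_trans (cd _ _ _ _ _))//; arith.
Qed.

Lemma lip_curve_trans x y z a b : 0 <= a -> 0 <= b ->
  lip_curve x y a -> lip_curve y z b -> lip_curve x z (a + b).
Proof.
move=> a0 b0 [c [c0 ca cd]] [e [e0 eb ed]].
exists (fun s => if s <= a then c s else e (s - a)); split.
- by rewrite a0.
- case: ifP => h; last by rewrite addrAC subrr add0r.
  have b00 : b = 0 by arith.
  by rewrite b00 addr0 ca -e0 -eb b00.
- move=> s t s0 st tab; have [ta|ta] := leP t a.
    by rewrite (le_trans st ta); apply: cd.
  have [sa|sa] := leP s a; last by rewrite (le_trans (ed _ _ _ _ _))//; arith.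
  have := dT (c s) (c a) (e (t - a)).
  have := cd s a s0 sa (lexx a); rewrite ca -{1}e0.
  have := ed 0 (t - a) (lexx 0) ltac:(arith) ltac:(arith); rewrite e0; arith.
Qed.

(* A 1-Lipschitz curve whose length is the distance of its endpoints is
   geodesic, so geodesics can be built by concatenation. *)
Lemma lip_curve_geodesic : (forall x y, 0 <= d x y) ->
  (forall x y, lip_curve x y (d x y)) -> geodesic_space d.
Proof.
move=> d0 h x y; have [c [c0 c1 cd]] := h x y; exists c; split=> //; split=> //.
suff H s t : 0 <= s -> s <= t -> t <= d x y -> d (c s) (c t) = t - s.
  move=> s t /andP[s0 s1] /andP[t0 t1]; have [st|ts] := leP s t.
    by rewrite H// distrC ger0_norm ?subr_ge0.
  by rewrite dC H ?(ltW ts)// ger0_norm// subr_ge0 ltW.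
move=> s0 st t1; apply/eqP; rewrite eq_le cd//=.
have := cd 0 s (lexx 0) s0 (le_trans st t1).
have := cd t (d x y) (le_trans s0 st) t1 (lexx _); rewrite c0 c1.
have := dT x (c s) y; have := dT (c s) (c t) y; arith.
Qed.

End LipschitzCurves.

(** * Two-sided group identities from the left axioms *)

Section GroupTheory.
Variable G : group.
Implicit Types x y : G.

Lemma gmulKV x y : gmul (ginv x) (gmul x y) = y.
Proof. by rewrite gmulA gmulV gmul1. Qed.

Lemma gmulI x y z : gmul x y = gmul x z -> y = z.
Proof. by move=> h; rewrite -(gmulKV x y) h gmulKV. Qed.

Lemma gmulr1 x : gmul x gone = x.
Proof. by apply: (@gmulI (ginv x)); rewrite gmulA gmulV gmul1. Qed.

Lemma gmulrV x : gmul x (ginv x) = gone.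
Proof. by apply: (@gmulI (ginv x)); rewrite gmulKV gmulr1. Qed.

Lemma gmulVK x y : gmul x (gmul (ginv x) y) = y.
Proof. by rewrite gmulA gmulrV gmul1. Qed.

Lemma ginv_eq x y : gmul x y = gone -> ginv x = y.
Proof. by move=> h; rewrite -(gmulKV x y) h gmulr1. Qed.

Lemma ginvK x : ginv (ginv x) = x.
Proof. exact/ginv_eq/gmulV. Qed.

Lemma ginvM x y : ginv (gmul x y) = gmul (ginv y) (ginv x).
Proof. by apply: ginv_eq; rewrite -gmulA gmulVK gmulrV. Qed.

End GroupTheory.

HB.instance Definition _ (G : group) := gen_eqMixin (gcar G).

(** * The word metric and the geodesic metric of the Cayley graph *)

Section WordMetric.
Context {R : realType} {G : group} {n : nat}.
Variable S : 'I_n -> G.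
Hypothesis gen : generates S.
Implicit Types (g h : G) (w : seq ('I_n * bool)).

Local Notation D := (word_dist R S).

Lemma word_eval_cat w w' :
  word_eval S (w ++ w') = gmul (word_eval S w) (word_eval S w').
Proof. by elim: w => [|l w IH] /=; rewrite ?gmul1// IH gmulA. Qed.

Lemma word_eval_inv w :
  word_eval S (rev [seq (l.1, ~~ l.2) | l <- w]) = ginv (word_eval S w).
Proof.
elim: w => [|[i b] w IH] /=; first by apply/esym/ginv_eq; rewrite gmul1.
rewrite rev_cons -cats1 word_eval_cat IH /= gmulr1 ginvM.
by case: b; rewrite /= ?ginvK.
Qed.

(** The infimum runs over a set of natural numbers, nonempty since [S] generates, so a shortest word
    exists. *)
Lemma word_dist_min g h : exists w, [/\ word_eval S w = gmul (ginv g) h,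
  D g h = (size w)%:R &
  forall w', word_eval S w' = gmul (ginv g) h -> (size w <= size w')%N].
Proof.
pose P k := `[< exists2 w, word_eval S w = gmul (ginv g) h & size w = k >].
have exP : exists k, P k.
  by have [w hw] := gen (gmul (ginv g) h); exists (size w); apply/asboolP; exists w.
have [k /asboolP[w hw wk] kmin] := ex_minnP exP.
have wmin w' : word_eval S w' = gmul (ginv g) h -> (size w <= size w')%N.
  by move=> hw'; rewrite wk; apply: kmin; apply/asboolP; exists w'.
exists w; split=> //; apply/eqP; rewrite eq_le; apply/andP; split.
  by apply: ge_inf; [exists 0 => _ [w' _ <-]|exists w].
apply: lb_le_inf; first by exists (size w)%:R, w.
by move=> _ [w' hw' <-]; rewrite ler_nat; exact: wmin.
Qed.

Lemma word_dist_le g h w : word_eval S w = gmul (ginv g) h -> D g h <= (size w)%:R.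
Proof. by have [v [_ -> vm]] := word_dist_min g h; move/vm; rewrite ler_nat. Qed.

Lemma word_dist_ge0 g h : 0 <= D g h.
Proof. by have [w [_ -> _]] := word_dist_min g h. Qed.

Lemma word_distxx g : D g g = 0.
Proof.
apply/eqP; rewrite eq_le word_dist_ge0 andbT.
by apply: (word_dist_le (w := [::])); rewrite gmulV.
Qed.

Lemma word_distC g h : D g h = D h g.
Proof.
suff H x y : D x y <= D y x by apply/eqP; rewrite eq_le !H.
have [w [wE -> _]] := word_dist_min y x.
rewrite -(size_map (fun l => (l.1, ~~ l.2)) w) -size_rev.
by apply: word_dist_le; rewrite word_eval_inv wE ginvM ginvK.
Qed.

Lemma word_dist_triangle g h k : D g k <= D g h + D h k.
Proof.
have [w [wE -> _]] := word_dist_min g h; have [v [vE -> _]] := word_dist_min h k.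
rewrite -natrD -size_cat; apply: word_dist_le.
by rewrite word_eval_cat wE vE -gmulA gmulVK.
Qed.

Lemma word_dist_edge g i : D g (gmul g (S i)) <= 1.
Proof. by apply: (word_dist_le (w := [:: (i, false)])); rewrite /= gmulr1 gmulKV. Qed.

Lemma word_dist_gmul k g h : D (gmul k g) (gmul k h) = D g h.
Proof. by rewrite /word_dist ginvM -gmulA gmulKV. Qed.

Lemma foldr_min_le (x0 y : R) (L : seq R) : y \in L -> foldr Num.min x0 L <= y.
Proof.
elim: L => //= x L IH; rewrite inE => /orP[/eqP ->|/IH h]; rewrite ge_min ?lexx//.
by rewrite h orbT.
Qed.

Lemma foldr_min_in (x0 : R) (L : seq R) : foldr Num.min x0 L \in x0 :: L.
Proof.
elim: L => [|x L IH] /=; first exact: mem_head.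
rewrite minEle; case: ifP => _; rewrite ?inE ?eqxx ?orbT//.
by move: IH; rewrite !inE => /orP[->|->]; rewrite ?orbT.
Qed.

Local Notation d := (cdist R S).
Local Notation X := (cpoint R G n).

(** The direct route inside one open edge, as opposed to a route through end vertices. *)
Definition same_edge (p q : X) (c : R) : Prop :=
  match p, q with
  | CE g i t, CE h j u => [/\ g = h, i = j & c = `|sval t - sval u|]
  | _, _ => False
  end.

Lemma cdist_le_ends p q x y : x \in cends S p -> y \in cends S q ->
  d p q <= x.2 + D x.1 y.1 + y.2.
Proof.
move=> xp yq; rewrite /cdist.
set L := [seq x.2 + D x.1 y.1 + y.2 | x <- cends S p, y <- cends S q].
have h : foldr Num.min (head 0 L) L <= x.2 + D x.1 y.1 + y.2.
  apply: foldr_min_le; rewrite /L.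
  exact: (allpairs_f (fun x y : G * R => x.2 + D x.1 y.1 + y.2)).
case: p @L {xp yq} h => [g|g i t]; case: q => [g'|g' i' t'] //= h.
by case: asboolP => // _; rewrite ge_min h orbT.
Qed.

Lemma cdist_le_edge p q c : same_edge p q c -> d p q <= c.
Proof.
case: p => [//|g i t]; case: q => [//|h j u] [-> -> ->].
by rewrite /cdist; case: asboolP => [_|[]//]; rewrite ge_min lexx.
Qed.

(** A finite minimum is attained. Together with [cdist_le_ends] and [cdist_le_edge] this
    characterises [cdist], which need not be unfolded afterwards. *)
Lemma cdist_cases p q : same_edge p q (d p q) \/ exists x y,
  [/\ x \in cends S p, y \in cends S q & d p q = x.2 + D x.1 y.1 + y.2].
Proof.
rewrite /cdist; set L := [seq x.2 + D x.1 y.1 + y.2 | x <- cends S p, y <- cends S q].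
have : foldr Num.min (head 0 L) L \in L.
  have := foldr_min_in (head 0 L) L; rewrite inE => /orP[/eqP e|//].
  rewrite e; have : (0 < size L)%N.
    by rewrite /L size_allpairs; case: (p) => *; case: (q).
  by case: (L) => //= *; exact: mem_head.
set b := foldr _ _ _; move=> /allpairsP[[x y] /= [xp yq bE]].
have R2 : exists x y, [/\ x \in cends S p, y \in cends S q &
    b = x.2 + D x.1 y.1 + y.2] by exists x, y.
clearbody b; case: p L xp R2 => [g|g i t] L xp R2; try by right.
case: q L yq R2 => [h|h j u] L yq R2; try by right.
case: asboolP => [[gh ij]|_]; last by right.
by rewrite minEle; case: ifP => _; [left|right].
Qed.

Lemma cends_ge0 (p : X) x : x \in cends S p -> 0 <= x.2 <= 1.
Proof.
case: p => [g|g i [t ht]] /=; rewrite !inE.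
  by move=> /eqP ->; rewrite /= lexx ler01.
move=> /orP[] /eqP -> /=; arith.
Qed.

Lemma cends_edge (p : X) x y : x \in cends S p -> y \in cends S p ->
  D x.1 y.1 <= x.2 + y.2.
Proof.
case: p => [g|g i [t ht]] /=; rewrite !inE.
  by move=> /eqP -> /eqP ->; rewrite word_distxx addr0.
have := word_dist_edge g i.
by move=> ? /orP[] /eqP -> /orP[] /eqP -> /=; rewrite ?word_distxx ?(word_distC _ g); arith.
Qed.

Lemma same_edge_ends (p q : X) c y : same_edge p q c -> y \in cends S q ->
  exists2 a, (y.1, a) \in cends S p & a <= y.2 + c.
Proof.
case: p => [//|g i [t ht]]; case: q => [//|h j [u hu]] /= [-> -> ->].
have h1 := ler_norm (t - u); have h2 := ler_norm (u - t); rewrite distrC in h2.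
rewrite !inE => /orP[] /eqP -> /=.
  by exists t; [rewrite !inE eqxx|arith].
by exists (1 - t); [rewrite !inE eqxx orbT|arith].
Qed.

Lemma cdist_ge0 p q : 0 <= d p q.
Proof.
have [|[x [y [/cends_ge0 + /cends_ge0 + ->]]]] := cdist_cases p q.
  by case: p => [//|g i t]; case: q => [//|h j u] [_ _ ->].
have := word_dist_ge0 x.1 y.1; arith.
Qed.

Lemma cdistxx p : d p p = 0.
Proof.
apply/eqP; rewrite eq_le cdist_ge0 andbT; case: p => [g|g i t].
  have gg : (g, 0 : R) \in cends S (CV g : X) by rewrite inE.
  by have := cdist_le_ends gg gg; rewrite /= word_distxx !addr0.
by apply: cdist_le_edge; split=> //; rewrite subrr normr0.
Qed.

Lemma same_edgeC p q c : same_edge p q c -> same_edge q p c.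
Proof.
by case: p => [//|g i t]; case: q => [//|h j u] [-> -> ->]; split=> //; rewrite distrC.
Qed.

Lemma cdistC p q : d p q = d q p.
Proof.
suff H p' q' : d p' q' <= d q' p' by apply/eqP; rewrite eq_le !H.
have [/same_edgeC|[x [y [xq yp ->]]]] := cdist_cases q' p'; first exact: cdist_le_edge.
by rewrite addrC (addrC x.2) addrA word_distC; exact: cdist_le_ends.
Qed.

(** Two routes through vertices are joined at [q] by [cends_edge]; a route inside an edge is
    absorbed into its neighbour by [same_edge_ends]; two of them on a common edge reduce to the real
    line. *)
Lemma cdist_triangle p q r : d p r <= d p q + d q r.
Proof.
have [pq|[x [y [xp yq ->]]]] := cdist_cases p q; last first.
  have [/same_edgeC qr|[y' [z [yq' zr ->]]]] := cdist_cases q r.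
    have [a ar ha] := same_edge_ends qr yq.
    apply: le_trans (cdist_le_ends xp ar) _ => /=; arith.
  apply: le_trans (cdist_le_ends xp zr) _.
  have := cends_edge yq yq'; have := word_dist_triangle x.1 y.1 z.1.
  have := word_dist_triangle y.1 y'.1 z.1; arith.
have [qr|[y [z [yq zr ->]]]] := cdist_cases q r; last first.
  have [a ap ha] := same_edge_ends pq yq.
  apply: le_trans (cdist_le_ends ap zr) _ => /=; arith.
case: p q r pq qr => [//|g i t] [//|h j u] [//|k l v] [e1 e2 ->] [e3 e4 ->].
by apply: le_trans (cdist_le_edge _) (ler_distD (sval u) _ _); rewrite e1 e2 e3 e4.
Qed.

Lemma cdist_vertices g h : d (CV g) (CV h) = D g h.
Proof.
have [//|[x [y [+ + ->]]]] := cdist_cases (CV g) (CV h).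
by rewrite !inE => /eqP -> /eqP -> /=; rewrite add0r addr0.
Qed.

(** Parametrises the closed edge, since [CE] covers only its interior. *)
Definition edge_point g (i : 'I_n) (t : R) : X :=
  match insub t : option {t : R | 0 < t < 1} with
  | Some u => CE g i u
  | None => if t <= 0 then CV g else CV (gmul g (S i))
  end.

Lemma edge_point0 g i : edge_point g i 0 = CV g.
Proof. by rewrite /edge_point insubN ?ltxx// lexx. Qed.

Lemma edge_point1 g i : edge_point g i 1 = CV (gmul g (S i)).
Proof. by rewrite /edge_point insubN ?ltxx ?andbF// lt_geF ?ltr01. Qed.

Lemma edge_pointE g i (t : {t : R | 0 < t < 1}) : edge_point g i (sval t) = CE g i t.
Proof. by rewrite /edge_point valK. Qed.

Lemma cdist_edge_point g i t u : 0 <= t <= 1 -> 0 <= u <= 1 ->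
  d (edge_point g i t) (edge_point g i u) <= `|t - u|.
Proof.
wlog tu : t u / t <= u.
  move=> H ht hu; have [tu|ut] := leP t u; first exact: H.
  by rewrite cdistC distrC; apply: H => //; exact: ltW.
move=> ht hu; rewrite distrC ger0_norm ?subr_ge0//.
have P v : 0 <= v <= 1 -> [\/ v = 0, v = 1 | exists w : {t : R | 0 < t < 1}, v = sval w].
  move=> hv; have [v0|v0] := leP v 0; first by apply: Or31; arith.
  have [v1|v1] := leP 1 v; first by apply: Or32; arith.
  by apply: Or33; exists (exist _ v (ltac:(by rewrite v0) : 0 < v < 1)).
have e0 : (g, 0 : R) \in cends S (CV g : X) by rewrite inE.
have e1 : (gmul g (S i), 0 : R) \in cends S (CV (gmul g (S i)) : X) by rewrite inE.
have gi := word_dist_edge g i.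
have [-> {tu ht}|t1|[w tE]] := P t ht; last first.
- rewrite tE edge_pointE.
  have wl : (gmul g (S i), 1 - sval w) \in cends S (CE g i w) by rewrite !inE eqxx orbT.
  have [u0|->|[v uE]] := P u hu.
  + by case: w tE {wl} => w hw /=; arith.
  + by rewrite edge_point1; have := cdist_le_ends wl e1; rewrite /= word_distxx; arith.
  + rewrite uE edge_pointE; apply: cdist_le_edge; split=> //.
    by rewrite distrC ger0_norm// subr_ge0 -uE -tE.
- have -> : u = t by arith.
  by rewrite cdistxx subrr.
- rewrite edge_point0; have [->|->|[v ->]] := P u hu.
  + by rewrite edge_point0 cdistxx subrr.
  + by rewrite edge_point1 cdist_vertices; arith.
  + rewrite edge_pointE.
    have vl : (g, sval v) \in cends S (CE g i v) by rewrite !inE eqxx.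
    by have := cdist_le_ends e0 vl; rewrite /= word_distxx; arith.
Qed.

Local Notation lip := (lip_curve d).

Lemma lip_edge g i t u : 0 <= t -> t <= u -> u <= 1 ->
  lip (edge_point g i t) (edge_point g i u) (u - t).
Proof.
move=> t0 tu u1; exists (fun s => edge_point g i (t + s)).
rewrite addr0 addrC subrK; split=> // a b a0 ab bu.
have -> : b - a = `|(t + a) - (t + b)|.
  by rewrite distrC ger0_norm; arith.
by apply: cdist_edge_point; arith.
Qed.

Lemma lip_end (p : X) x : x \in cends S p -> lip p (CV x.1) x.2.
Proof.
case: p => [g|g i t] /=; rewrite !inE.
  move=> /eqP -> /=; exists (fun=> CV g); split=> // s t s0 st t0.
  by rewrite cdistxx; arith.
have ht := svalP t; move=> /orP[] /eqP -> /=.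
  apply: (lip_curve_sym cdistC); rewrite -[X in lip _ _ X]subr0.
  rewrite -(edge_point0 g i) -(edge_pointE g i t).
  by apply: lip_edge; arith.
rewrite -(edge_point1 g i) -(edge_pointE g i t).
by apply: lip_edge; arith.
Qed.

Lemma lip_word g w : lip (CV g) (CV (gmul g (word_eval S w))) (size w)%:R.
Proof.
elim: w g => [|[i b] w IH] g /=.
  rewrite gmulr1; exists (fun=> CV g); split=> // s t s0 st t0.
  by rewrite cdistxx; arith.
rewrite -natr1 addrC gmulA; apply: (lip_curve_trans cdist_triangle _ _ _ (IH _)) => //.
rewrite -[1]subr0; case: b => /=.
  (* An inverse letter runs backwards along the edge that starts at [gmul g (ginv (S i))]. *)
  have {1}-> : g = gmul (gmul g (ginv (S i))) (S i) by rewrite -gmulA gmulV gmulr1.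
  apply: (lip_curve_sym cdistC).
  rewrite -(edge_point1 _ i) -(edge_point0 (gmul g _) i).
  by apply: lip_edge; rewrite ?lexx ?ler01.
rewrite -(edge_point1 _ i) -(edge_point0 g i).
by apply: lip_edge; rewrite ?lexx ?ler01.
Qed.

Lemma lip_cdist p q : lip p q (d p q).
Proof.
have [|[x [y [xp yq ->]]]] := cdist_cases p q; last first.
  have := cends_ge0 xp; have := cends_ge0 yq => hy hx.
  apply: (lip_curve_trans cdist_triangle) (lip_curve_sym cdistC (lip_end yq)).
  - by rewrite addr_ge0 ?word_dist_ge0//; arith.
  - arith.
  apply: (lip_curve_trans cdist_triangle) (lip_end xp) _; first by arith.
    exact: word_dist_ge0.
  have [w [wE -> _]] := word_dist_min x.1 y.1.
  by rewrite -[y.1](gmulVK x.1) -wE; exact: lip_word.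
case: p => [//|g i t]; case: q => [//|h j u] [<- <- ->].
rewrite -!edge_pointE; have := svalP t; have := svalP u.
have [tu|ut] := leP (sval t) (sval u) => hu ht.
  by rewrite distrC ger0_norm ?subr_ge0//; apply: lip_edge; arith.
rewrite ger0_norm ?subr_ge0 ?(ltW ut)//.
by apply: (lip_curve_sym cdistC); apply: lip_edge; arith.
Qed.

Lemma cdist_geodesic : geodesic_space d.
Proof. exact: lip_curve_geodesic cdistC cdist_triangle cdist_ge0 lip_cdist. Qed.

End WordMetric.

(** * Pigeonhole principle and extraction of subsequences *)

Lemma infinite_pigeonhole (T : finType) (f : nat -> T) :
  exists x, forall N, exists2 k, (N <= k)%N & f k = x.
Proof.
apply: contrapT => hn.
have /choice[B hB] : forall x : T, exists N, forall k, (N <= k)%N -> f k <> x.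
  move=> x; apply: contrapT => hx; apply: hn; exists x => N.
  by apply: contrapT => hN; apply: hx; exists N => k Nk fk; apply: hN; exists k.
by apply: (hB (f (\max_x B x)) (\max_x B x)) => //; exact: leq_bigmax.
Qed.

Lemma cluster_subsequence (R : realType) (X : Type) (d : X -> X -> R)
    (u : nat -> X) (y : X) :
    (forall (e : R) N, 0 < e -> exists2 k, (N <= k)%N & d (u k) y < e) ->
  exists phi : nat -> nat, (forall k, (phi k < phi k.+1)%N) /\
    forall e : R, 0 < e -> exists N, forall k, (N <= k)%N -> d (u (phi k)) y < e.
Proof.
move=> h.
have /choice[K hK] : forall jN : nat * nat, exists k,
    (jN.2 <= k)%N /\ d (u k) y < jN.1.+1%:R^-1.
  by move=> [j N]; have [|k] := h j.+1%:R^-1 N; [rewrite invr_gt0|exists k].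
pose phi := fix phi j := if j is i.+1 then K (j, (phi i).+1) else K (0, 0)%N.
exists phi; split=> [k|e e0]; first by have [] := hK (k.+1, (phi k).+1).
have phiE k : d (u (phi k)) y < k.+1%:R^-1.
  by case: k => [|k]; [have [] := hK (0, 0)%N|have [] := hK (k.+1, (phi k).+1)].
have ei : 0 < e^-1 by rewrite invr_gt0.
have /andP[_ he] := Num.Theory.truncn_itv (ltW ei).
exists (Num.truncn e^-1) => k Nk; apply: lt_trans (phiE k) _.
rewrite -[ltRHS]invrK ltf_pV2 ?posrE//.
by apply: lt_le_trans he _; rewrite ler_nat ltnS.
Qed.

(** * Properness and an infinite geodesic in the Cayley graph *)

Section CayleyGraph.
Context {R : realType} {G : group} {n : nat}.
Variable S : 'I_n -> G.
Hypothesis gen : generates S.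
Local Notation D := (word_dist R S).
Local Notation d := (cdist R S).
Local Notation X := (cpoint R G n).

(** Bolzano-Weierstrass on one edge: [sup E] is the upper limit of the parameters of the terms lying
    on it. *)
Lemma edge_cluster (g : G) i (u : nat -> X) :
    (forall N, exists2 k, (N <= k)%N &
       exists2 t, 0 <= t <= 1 & u k = edge_point S g i t) ->
  exists y, forall (e : R) N, 0 < e -> exists2 k, (N <= k)%N & d (u k) y < e.
Proof.
move=> ug.
pose E := [set t : R | 0 <= t <= 1 /\ forall N, exists2 k, (N <= k)%N &
   exists2 s, t <= s <= 1 & u k = edge_point S g i s].
have E0 : E 0 by split=> //; rewrite lexx ler01.
have Es : has_sup E by split; [exists 0|exists 1 => t [/andP[]]].
have s0 : 0 <= sup E by exact: (ub_le_sup Es.2).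
have s1 : sup E <= 1 by apply: ge_sup; [exists 0|move=> t [/andP[]]].
exists (edge_point S g i (sup E)) => e N e0.
have [t [t01 tE] te] := sup_adherent e0 Es.
have [N' hN'] : exists N', forall k, (N' <= k)%N -> forall s, 0 <= s <= 1 ->
    u k = edge_point S g i s -> s < sup E + e.
  apply: contrapT => hn.
  have [e1|e1] := leP (sup E + e) 1; last first.
    by apply: hn; exists 0%N => k _ s hs _; arith.
  suff /(ub_le_sup Es.2) : E (sup E + e) by arith.
  split=> [|M]; first by arith.
  apply: contrapT => hM; apply: hn; exists M => k Mk s hs uk.
  rewrite ltNge; apply/negP => hse; apply: hM; exists k => //; exists s => //.
  by rewrite hse; case/andP: hs.
have [k Nk [s hs uk]] := tE (maxn N N').
move: Nk; rewrite geq_max => /andP[Nk N'k].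
have := hN' k N'k s ltac:(arith) uk => hse.
exists k => //; rewrite uk; apply: le_lt_trans (cdist_edge_point _ _ _ _ _) _ => //; try arith.
by rewrite ltr_norml; arith.
Qed.

Lemma on_edge (i0 : 'I_n) (p : X) : exists g i t,
  [/\ 0 <= t <= 1, p = edge_point S g i t & d p (CV g) <= 1].
Proof.
case: p => [g|g i t].
  by exists g, i0, 0; rewrite edge_point0 cdistxx// lexx ler01.
exists g, i, (sval t); rewrite edge_pointE; have := svalP t => /= ht.
split=> //; first by arith.
have h1 : (g, sval t) \in cends S (CE g i t) by rewrite !inE eqxx.
have h2 : (g, 0 : R) \in cends S (CV g : X) by rewrite inE.
by have := cdist_le_ends h1 h2; rewrite /= word_distxx//; arith.
Qed.

(** A ball meets only finitely many edges, labelled by words of bounded length and a generator, so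
    one edge contains infinitely many terms. *)
Lemma cdist_proper (i0 : 'I_n) : proper_space d.
Proof.
move=> x r u ur.
have [v [_ [_ [_ _ xv]]]] := on_edge i0 x.
have dT := @cdist_triangle R _ _ _ gen; have dC := @cdistC R _ _ _ gen.
(* The start of the edge carrying [u k] is within [1 + r + 1] of [v]. *)
pose m := (Num.truncn (r + 2)).+1.
have /choice[c hc] : forall k, exists c : m.-bseq ('I_n * bool) * 'I_n,
    exists2 t, 0 <= t <= 1 &
      u k = edge_point S (gmul v (word_eval S c.1)) c.2 t.
  move=> k; have [g [i [t [ht uk kg]]]] := on_edge i0 (u k).
  have [w [wE wD _]] := @word_dist_min R _ _ _ gen v g.
  have wm : (size w <= m)%N.
    rewrite -(ler_nat R) -wD -(cdist_vertices S).
    have := dT (CV v) x (CV g); have := dT x (u k) (CV g); have := ur k.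
    have := @cdist_ge0 R _ _ _ gen x (u k).
    have := @truncn_bound _ (r + 2); rewrite -/m (dC _ x).
    move=> h1 h2 h3 h4 h5; have /andP[] := h1 ltac:(arith); arith.
  exists (Bseq wm, i), t => //=.
  by rewrite wE gmulVK.
have [[w i] hw] := infinite_pigeonhole c.
have [N|y hy] := @edge_cluster (gmul v (word_eval S w)) i u.
  by have [k Nk ck] := hw N; exists k => //; have := hc k; rewrite ck.
by have [phi [h1 h2]] := cluster_subsequence hy; exists phi, y.
Qed.

(** Geodesic words, not merely freely reduced ones. *)
Definition reduced (w : seq ('I_n * bool)) : Prop :=
  forall w', word_eval S w' = word_eval S w -> (size w <= size w')%N.

Lemma reduced_catl w w' : reduced (w ++ w') -> reduced w.
Proof.
move=> h v vw; have := h (v ++ w'); rewrite !word_eval_cat vw => /(_ erefl).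
by rewrite !size_cat leq_add2r.
Qed.

Lemma reduced_dist w : reduced w -> D gone (word_eval S w) = (size w)%:R.
Proof.
move=> rw; have [v [vE vD vm]] := @word_dist_min R _ _ _ gen gone (word_eval S w).
rewrite vD; congr _%:R; have v1 : gmul (ginv gone) (word_eval S w) = word_eval S w.
  by rewrite (ginv_eq (gmul1 gone)) gmul1.
apply/eqP; rewrite eqn_leq vm ?v1// rw//.
by rewrite vE v1.
Qed.

(* Koenig's lemma on the tree of geodesic words *)
Lemma geodesic_vertex_ray : (forall r : R, exists x, r < d (CV gone) x) ->
  exists v : nat -> G, [/\ v 0%N = gone, forall k, D gone (v k) = k%:R &
    forall k, D (v k) (v k.+1) <= 1].
Proof.
move=> unb.
pose P w := forall N, exists2 w', reduced (w ++ w') & (N <= size w')%N.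
have P0 : P [::].
  move=> N; have [x hx] := unb (N%:R + 1).
  have [y yx] : exists y, y \in cends S x.
    by case: (x) => [g|g i t]; eexists; exact: mem_head.
  have [w [wE wD wm]] := @word_dist_min R _ _ _ gen gone y.1.
  exists w; first by move=> w' /= w'E; apply: wm; rewrite w'E.
  rewrite -(ler_nat R) -wD.
  have e0 : (gone, 0 : R) \in cends S (CV gone : X) by rewrite inE.
  have h : d (CV gone) x <= 0 + D gone y.1 + y.2 := cdist_le_ends e0 yx.
  have := cends_ge0 yx; arith.
(* There are finitely many letters: were the extensions through each of them bounded, all extensions
   of [w] would be. *)
have Pstep w : P w -> exists l, P (rcons w l).
  move=> Pw; apply: contrapT => hn.
  have /choice[B hB] : forall l, exists N, forall w',
      reduced (rcons w l ++ w') -> (size w' < N)%N.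
    move=> l; apply: contrapT => hl; apply: hn; exists l => N.
    apply: contrapT => hN; apply: hl; exists N => w' rw'.
    by rewrite ltnNge; apply/negP => h; apply: hN; exists w'.
  have [[//|l w'] rw] := Pw (\max_l B l).+1.
  rewrite -cat_rcons in rw; have := hB _ _ rw => h1; rewrite /= ltnS => h2.
  by have := leq_trans h1 (leq_trans (leq_bigmax l) h2); rewrite ltnn.
have /choice[f hf] : forall w, exists l, P w -> P (rcons w l).
  move=> w; have [/Pstep[l hl]|nP] := pselect (P w); first by exists l.
  have [l _] := Pstep _ P0; by exists l.
pose W := fix W k := if k is j.+1 then rcons (W j) (f (W j)) else [::].
have PW k : P (W k) by elim: k => //= k IH; exact: hf.
have sW k : size (W k) = k by elim: k => //= k IH; rewrite size_rcons IH.
exists (fun k => word_eval S (W k)); split=> // k.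
  by rewrite reduced_dist ?sW//; have [w' /reduced_catl] := PW k 0%N.
have -> : 1 = (size [:: f (W k)])%:R :> R by [].
by apply: word_dist_le => //; rewrite /= -cats1 word_eval_cat gmulKV.
Qed.

End CayleyGraph.

(** * Quasi-geodesic rays starting at every point *)

Section Rays.
Context {R : realType} {G : group} {n : nat}.
Variable S : 'I_n -> G.
Hypothesis gen : generates S.
Local Notation D := (word_dist R S).
Local Notation d := (cdist R S).
Local Notation X := (cpoint R G n).

Lemma generator_exists (x : X) : 0 < d (CV gone) x -> inhabited 'I_n.
Proof.
case: x => [g|? i t] ox; last by exists.
have [[|[i ?] w] wg] := gen g; last by exists.
by move: ox; rewrite -wg cdistxx// ltxx.
Qed.

Variable v : nat -> G.
Hypothesis v0 : v 0%N = gone.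
Hypothesis vD : forall k, D gone (v k) = k%:R.
Hypothesis v1 : forall k, D (v k) (v k.+1) <= 1.

Lemma vertex_ray_dist i j : D (v i) (v j) = `|i%:R - j%:R|.
Proof.
wlog ij : i j / (i <= j)%N.
  by move=> H; have [/H//|/ltnW/H] := leqP i j; rewrite distrC (word_distC gen).
rewrite distrC ger0_norm ?subr_ge0 ?ler_nat//.
apply/eqP; rewrite eq_le; apply/andP; split; last first.
  by have := @word_dist_triangle R _ _ _ gen gone (v i) (v j); rewrite !vD; arith.
rewrite -natrB// -{1}(subnKC ij); elim: (j - i)%N => [|l IH].
  by rewrite addn0 word_distxx.
rewrite addnS -natr1; have := v1 (i + l).
have := @word_dist_triangle R _ _ _ gen (v i) (v (i + l)%N) (v (i + l).+1); arith.
Qed.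

(* Moving the initial point by at most 1 keeps a translate of the vertex ray
   quasi-geodesic, as quasi-geodesics need not be continuous. *)
Definition ray_from (x : X) (g : G) (t : R) : X :=
  if t <= 0 then x else CV (gmul g (v (Num.truncn t))).

(** Of the additive error 2, one unit comes from rounding times and one from the moved initial
    point. *)
Lemma ray_from_qgeod x g : d x (CV g) <= 1 -> qgeod d 1 2 [set t | 0 <= t] (ray_from x g).
Proof.
have dT := @cdist_triangle R _ _ _ gen; have dC := @cdistC R _ _ _ gen.
move=> xg; apply/(qgeodP dC); first by arith.
have gD i j : d (CV (gmul g (v i))) (CV (gmul g (v j))) = `|i%:R - j%:R|.
  by rewrite cdist_vertices word_dist_gmul vertex_ray_dist.
move=> s t /andP[s0 st]; rewrite !mul1r /ray_from.
have /andP[s1 s2] := Num.Theory.truncn_itv s0.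
have /andP[t1 t2] := Num.Theory.truncn_itv (le_trans s0 st).
rewrite -natr1 in s2; rewrite -natr1 in t2.
have [hs|hs] := leP s 0; have [ht|ht] := leP t 0.
- by rewrite cdistxx//; split; arith.
- have := gD 0%N (Num.truncn t); rewrite v0 gmulr1 distrC subr0 ger0_norm// => h.
  have h1 := dT x (CV g) (CV (gmul g (v (Num.truncn t)))).
  have h2 := dT (CV g) x (CV (gmul g (v (Num.truncn t)))).
  by rewrite (dC (CV g) x) in h2; split; arith.
- by exfalso; arith.
- have ij : (Num.truncn s)%:R <= (Num.truncn t)%:R :> R.
    by rewrite ler_nat; apply: Num.Theory.le_truncn.
  by rewrite gD distrC ger0_norm ?subr_ge0//; split; arith.
Qed.

End Rays.

(** * All rays form a single class *)

Theorem theorem1p1 (R : realType) (G : group) (n : nat) (S : 'I_n -> G) :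
  injective S -> generates S ->
  one_ended (cdist R S) (CV gone) ->
  linear_divergence (cdist R S) (CV gone) ->
  QR_assumptions (cdist R S) (CV gone) /\
  (forall a b : R -> cpoint R G n,
     is_qray (cdist R S) (CV gone) a -> is_qray (cdist R S) (CV gone) b ->
     qr_eq (cdist R S) (CV gone) a b) /\
  exists C, QRposet (cdist R S) (CV gone) = [set C].
Proof.
move=> _ gen [unb _] [C [C0 div]].
set d := cdist R S; set o : cpoint R G n := CV gone.
have dxx := @cdistxx R _ _ _ gen.
have dT := @cdist_triangle R _ _ _ gen; have dC := @cdistC R _ _ _ gen.
have geo := @cdist_geodesic R _ _ _ gen.
have le_all a b : is_qray d o a -> is_qray d o b -> qr_le d o a b.
  by move=> ra rb; exact: (qr_le_total dxx dC dT geo C0 div ra rb).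
have eq_all a b : is_qray d o a -> is_qray d o b -> qr_eq d o a b.
  by move=> ra rb; split; exact: le_all.
have [v [v0 vD v1]] := geodesic_vertex_ray gen unb.
have rayP x g := ray_from_qgeod gen v0 vD v1 (x := x) (g := g).
pose rho := ray_from v o gone.
have rho_ray : qray d o 1 2 rho.
  by split; [rewrite /rho /ray_from lexx|apply: rayP; rewrite dxx ler01].
have rho_qray : is_qray d o rho by exists 1, 2; rewrite lexx ler0n.
have [x0 ox0] := unb 0; have [i0] := generator_exists gen ox0.
have classE a : is_qray d o a -> qr_class d o a = [set b | is_qray d o b].
  move=> ra; apply/seteqP; split=> b; first by case.
  by move=> rb; split=> //; exact: eq_all.
split; [|split] => //; last first.
  exists [set b | is_qray d o b]; apply/seteqP; split=> A.
    by move=> [a [ra ->]]; exact: classE.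
  by move=> /= ->; exists rho; split=> //; rewrite classE.
exists 1, 2; split=> //; split=> //; split.
  split; first exact: cdist_proper.
  split=> // x; have [g [_ [_ [_ _ xg]]]] := on_edge gen i0 x.
  exists (ray_from v x g), 0; split; first exact: rayP.
  by rewrite /ray_from lexx.
exists (fun=> rho); split=> A [a [ra ->]]; first by rewrite classE.
(* Any [f] works: all rays are comparable, so the failure of [class_le] required by [class_lt] is
   contradictory. *)
exists id; split=> // B [b [rb ->]] [_ []].
by rewrite !classE//; exists a, b; split=> //; split=> //; exact: le_all.
Qed.
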